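(* Let $N \geq 2$ and let $\mathcal{M}$ be an $M$-element matching of the complete graph $K_N$. Then \[ \mathrm{NVol}\bigl(\nabla^{\mathrm{PQ}}_{K_N \triangle \mathcal{M}}\bigr) = 3^M\binom{2(N-1)}{N-1}. \]
   Context: For a simple undirected graph $G$ on vertex set $[n]=\{1,\dots,n\}$, the type-PQ adjacency polytope is $\nabla^{\mathrm{PQ}}_G = \mathrm{conv}\{(\mathbf{e}_i,\mathbf{e}_j) \in \mathbb{R}^{2n} : i=j \text{ or } ij \in E(G)\}$, where $\mathbf{e}_i$ is the $i$th standard basis vector of $\mathbb{R}^n$ (an edge $ij$ contributes both $(\mathbf{e}_i,\mathbf{e}_j)$ and $(\mathbf{e}_j,\mathbf{e}_i)$); for graphs on other finite vertex sets, identify the vertex set with $[n]$ by any bijection (the normalized volume does not depend on the choice). For a polytope $P$, $\mathrm{NVol}(P) = \dim(P)!\,\mathrm{vol}(P)$, where $\mathrm{vol}$ is the relative Euclidean volume in the affine span of $P$. For a graph $G$ and a set $F$ of edges of $G$, $G \triangle F$ is the graph obtained from $G$ by adding, for each edge $e = uv \in F$, a new vertex $w_e$ together with the edges $uw_e$ and $vw_e$ (distinct edges get distinct new vertices). *)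

(* Defs.v *)
From HB Require Import structures.
From mathcomp Require Import all_boot all_order all_algebra.
From mathcomp Require Import all_classical all_reals all_analysis.

Set Implicit Arguments.
Unset Strict Implicit.
Unset Printing Implicit Defensive.

Import Order.TTheory GRing.Theory Num.Theory.

Local Open Scope classical_set_scope.
Local Open Scope ring_scope.

Record sgraph (V : finType) := SGraph {
  adj : rel V;
  adj_sym : symmetric adj;
  adj_irr : irreflexive adj }.

Definition edges (V : finType) (G : sgraph V) : {set {set V}} :=
  [set [set uv.1; uv.2]%SET | uv in [pred uv : V * V | adj G uv.1 uv.2]]%SET.

Definition is_matching (V : finType) (G : sgraph V) (F : {set {set V}}) : bool :=
  (F \subset edges G) && finset.trivIset F.

Section CompleteGraph.
Variable N : nat.

Definition complete_adj : rel 'I_N := fun i j => i != j.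

Lemma complete_adj_sym : symmetric complete_adj.
Proof. by move=> i j; rewrite /complete_adj eq_sym. Qed.

Lemma complete_adj_irr : irreflexive complete_adj.
Proof. by move=> i; rewrite /complete_adj eqxx. Qed.

Definition complete_graph : sgraph 'I_N :=
  SGraph complete_adj_sym complete_adj_irr.

End CompleteGraph.

Section TriangleGraph.
Variables (V : finType) (G : sgraph V) (F : {set {set V}}).

(* [inl v] is an original vertex, [inr e] is the new vertex w_e. *)
Definition triangle_vertex : finType := (V + {e : {set V} | e \in F})%type.

Definition triangle_adj : rel triangle_vertex := fun x y =>
  match x, y with
  | inl u, inl v => adj G u v
  | inl u, inr e | inr e, inl u => u \in val e
  | inr _, inr _ => false
  end.

Lemma triangle_adj_sym : symmetric triangle_adj.
Proof. by move=> [u|e] [v|f] //=; rewrite adj_sym. Qed.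

Lemma triangle_adj_irr : irreflexive triangle_adj.
Proof. by move=> [u|e] //=; rewrite adj_irr. Qed.

Definition triangle_graph : sgraph triangle_vertex :=
  SGraph triangle_adj_sym triangle_adj_irr.

End TriangleGraph.

Section Polytopes.
Variable R : realType.

Definition affine_hull (d : nat) (A : set 'rV[R]_d) : set 'rV[R]_d :=
  [set x | exists m (p : 'I_m -> 'rV[R]_d) (w : 'I_m -> R),
    [/\ forall i, A (p i), \sum_i w i = 1 & x = \sum_i w i *: p i]].

Definition convex_hull (d : nat) (A : set 'rV[R]_d) : set 'rV[R]_d :=
  [set x | exists m (p : 'I_m -> 'rV[R]_d) (w : 'I_m -> R),
    [/\ forall i, A (p i), forall i, 0 <= w i,
        \sum_i w i = 1 & x = \sum_i w i *: p i]].

(* Dimension of the affine hull; the largest k is taken over a set with a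
   single element whenever P is nonempty. *)
Definition pdim (d : nat) (P : set 'rV[R]_d) : nat :=
  \max_(k < d.+1 | `[< exists (p : 'rV[R]_d) (B : 'M[R]_(k, d)),
      row_free B /\ affine_hull P = [set p + c *m B | c in [set: 'rV[R]_k]] >]) k.

(* k-dimensional Lebesgue measure of a Borel set, as the iterated product of
   the Lebesgue measure on the line: integrate over the first coordinate the
   (k-1)-dimensional measure of the sections. *)
Fixpoint lebesgue_rV (k : nat) : set 'rV[R]_k -> \bar R :=
  match k with
  | 0 => fun A => (\1_A (0 : 'rV[R]_0) : R)%:E
  | k'.+1 => fun A =>
      (\int[lebesgue_measure]_(t in [set: R])
         lebesgue_rV [set y : 'rV[R]_k' | A (row_mx (t%:M : 'rV[R]_1) y)])%E
  end.

Definition intmx (m n : nat) (A : 'M[int]_(m, n)) : 'M[R]_(m, n) :=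
  map_mx intr A.

(* c |-> p + c B is a bijection from R^k onto the affine hull of P that
   identifies Z^k with the integer points of this hull. *)
Definition lattice_chart (d : nat) (P : set 'rV[R]_d) (k : nat)
    (p : 'rV[int]_d) (B : 'M[int]_(k, d)) : Prop :=
  [/\ row_free (intmx B),
      affine_hull P = [set intmx p + c *m intmx B | c in [set: 'rV[R]_k]]
    & forall z : 'rV[int]_d, affine_hull P (intmx z) ->
        exists c : 'rV[int]_k, z = p + c *m B].

(* Relative volume of a lattice polytope: Lebesgue measure in the affine hull
   of P, scaled so that a fundamental parallelepiped of the lattice of integer
   points of that hull has volume 1.  The value does not depend on the chart,
   since two charts differ by an affine unimodular transformation. *)
Definition relvol (d : nat) (P : set 'rV[R]_d) : \bar R :=
  get [set v | exists (p : 'rV[int]_d) (B : 'M[int]_(pdim P, d)),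
    lattice_chart P p B /\
    v = lebesgue_rV [set c : 'rV[R]_(pdim P) | P (intmx p + c *m intmx B)]].

Definition NVol (d : nat) (P : set 'rV[R]_d) : \bar R :=
  (((pdim P)`!)%:R%:E * relvol P)%E.

(* Vertices are identified with coordinates through [enum_rank]. *)
Definition PQ_point (V : finType) (i j : V) : 'rV[R]_(#|V| + #|V|) :=
  row_mx (delta_mx 0 (enum_rank i)) (delta_mx 0 (enum_rank j)).

Definition PQ_polytope (V : finType) (G : sgraph V) : set 'rV[R]_(#|V| + #|V|) :=
  convex_hull [set x | exists i j : V, (i = j \/ adj G i j) /\ x = PQ_point i j].

End Polytopes.

Arguments PQ_polytope R {V} G.

(* Main.v *)
(** Write the points of R^{2n} as (a, b).  The polytope is cut out of the plane
  {sum of a = sum of b = 1} by a, b >= 0 and, for each matching edge e = uv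
  with new vertex w, by a_w <= b_w + b_u + b_v and b_w <= a_w + a_u + a_v: a
  point satisfying these inequalities is decomposed along an explicit flow on
  the edges of the bipartite graph.  Since all the facet forms are integral and homogeneous,
  comparing the polytope with cells of a fine grid shows that in any lattice
  chart its volume is the leading coefficient of the number of lattice points
  of its m-fold dilation, for which no change of variables is required.

  The lattice points are counted by a double generating series in which x and
  y mark the sums of a and of b.  With X = 1/(1-x), Y = 1/(1-y), Z = 1/(1-xy), an
  unmatched vertex contributes XY, and a matching edge together with its new
  vertex contributes
    2 Z^2 X^2 Y^2 - Z X^2 Y^2 + (Z^3 - Z^2) (X Y^2 + X^2 Y).
  On the diagonal, the leading coefficient of X^p Y^q is 'C(p + q - 2, p - 1),
  and Z raises the degree by one without changing the leading coefficient, so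
  by Pascal's rule each edge contributes a factor 2 + 1 = 3. *)

Require Import Defs.
From mathcomp Require Import all_boot all_order all_algebra.
From mathcomp Require Import all_classical all_reals all_analysis.
From mathcomp Require Import measurable_realfun.
From mathcomp Require Import ring lra zify.

Set Implicit Arguments.
Unset Strict Implicit.
Unset Printing Implicit Defensive.

Import Order.TTheory GRing.Theory Num.Theory numFieldNormedType.Exports.

(** * Grid approximation of the iterated Lebesgue measure *)

Section GridVolume.
Local Open Scope classical_set_scope.
Local Open Scope ring_scope.
Variable R : realType.
Local Notation mu := (@lebesgue_measure R).

Lemma lebesgue_rV_ge0 (k : nat) (A : set 'rV[R]_k) : (0 <= lebesgue_rV A)%E.
Proof.
elim: k A => [|k IH] A /=; first by rewrite lee_fin indicE.
by apply: integral_ge0 => t _; exact: IH.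
Qed.

(* [ge0_le_integral] does not apply: the section measures of an arbitrary set
   need not be measurable. *)
Lemma le_integral_nonneg (f g : R -> \bar R) :
  (forall t, 0 <= f t)%E -> (forall t, f t <= g t)%E ->
  (\int[mu]_(t in [set: R]) f t <= \int[mu]_(t in [set: R]) g t)%E.
Proof.
move=> f0 fg; have g0 t : (0 <= g t)%E by exact: le_trans (fg t).
rewrite !ge0_integralTE //; apply: ge_ereal_sup => _ [h hf <-].
by apply: ereal_sup_ubound; exists h => // x; apply: le_trans (fg x).
Qed.

(** Half-open, so that for m > 0 the cells of mesh 1/m partition the line and a real number
    determines its cell; the scaled form of the inequalities avoids division. *)
Definition cell (m : nat) (z : int) : set R :=
  [set t | z%:~R <= m%:R * t < z%:~R + 1].

Definition cube (m k : nat) (c : 'rV[int]_k) : set 'rV[R]_k :=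
  [set x | forall i, cell m (c 0 i) (x 0 i)].

Lemma cell_itv (m : nat) (z : int) : (0 < m)%N ->
  cell m z = [set` `[z%:~R / m%:R, (z%:~R + 1) / m%:R[].
Proof.
move=> m0; have mp : 0 < m%:R :> R by rewrite ltr0n.
apply/seteqP; split => t /=; rewrite in_itv /= ler_pdivrMr // ltr_pdivlMr //;
  by rewrite [t * _]mulrC.
Qed.

Lemma measurable_cell (m : nat) (z : int) : (0 < m)%N -> measurable (cell m z).
Proof. by move=> m0; rewrite cell_itv //; exact: measurable_itv. Qed.

Lemma lebesgue_measure_cell (m : nat) (z : int) : (0 < m)%N ->
  mu (cell m z) = (m%:R^-1)%:E.
Proof.
move=> m0; have mp : 0 < m%:R :> R by rewrite ltr0n.
rewrite cell_itv // lebesgue_measure_itv /= lte_fin ltr_pM2r ?invr_gt0 //.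
by rewrite ltrDl ltr01 -EFinB -mulrBl addrAC subrr add0r mul1r.
Qed.

Lemma cell_inj (m : nat) (y z : int) (t : R) : cell m y t -> cell m z t -> y = z.
Proof.
move=> /andP[y1 y2] /andP[z1 z2].
have : y%:~R < z%:~R + 1 :> R by exact: le_lt_trans z2.
have : z%:~R < y%:~R + 1 :> R by exact: le_lt_trans y2.
rewrite -[1]/(1%:~R) -!intrD !ltr_int; lia.
Qed.

(** Peels off the coordinate over which [lebesgue_rV] integrates first, to prepare the inductions on
    dimension. *)
Lemma cubeP (m k : nat) (c : 'rV[int]_k.+1) (t : R) (y : 'rV[R]_k) :
  cube m c (row_mx (t%:M : 'rV[R]_1) y) <->
  cell m (c 0 ord0) t /\ cube m (\row_i c 0 (lift ord0 i)) y.
Proof.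
have e0 : (row_mx (t%:M : 'rV[R]_1) y : 'rV_(1 + k)) 0 ord0 = t.
  have -> : ord0 = lshift k (ord0 : 'I_1) by exact/val_inj.
  by rewrite row_mxEl mxE eqxx.
have eS i : (row_mx (t%:M : 'rV[R]_1) y : 'rV_(1 + k)) 0 (lift ord0 i) = y 0 i.
  have -> : lift ord0 i = rshift 1 i by exact/val_inj.
  by rewrite row_mxEr.
split.
- move=> H; split; first by have := H ord0; rewrite e0.
  by move=> i; have := H (lift ord0 i); rewrite eS mxE.
- move=> [H0 H] i; case: (unliftP ord0 i) => [j|] ->; last by rewrite e0.
  by rewrite eS; have := H j; rewrite mxE.
Qed.

(** The section at t of the union of the cubes listed in [s]; a list keeps multiplicities, so that
    its size is exactly a sum of indicators. *)
Definition fiber (m k : nat) (s : seq 'rV[int]_k.+1) (t : R) : seq 'rV[int]_k :=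
  [seq \row_i c 0 (lift ord0 i) | c : 'rV[int]_k.+1 <- s & `[< cell m (c 0 ord0) t >]].

Lemma size_fiber (m k : nat) (s : seq 'rV[int]_k.+1) (t : R) :
  (size (fiber m s t))%:R = \sum_(c <- s) \1_(cell m (c 0 ord0)) t :> R.
Proof.
rewrite size_map size_filter -sum1_count natr_sum big_mkcond /=.
apply: eq_bigr => c _; rewrite indicE.
by case: ifPn => /asboolP ct; [rewrite mem_set | rewrite memNset].
Qed.

(** Each cube contributes the indicator of one cell, of length 1/m, which accounts for the
    additional factor m in the denominator. *)
Lemma integral_size_fiber (m k : nat) (s : seq 'rV[int]_k.+1) : (0 < m)%N ->
  (\int[mu]_(t in [set: R]) ((size (fiber m s t))%:R / m%:R ^+ k)%:E =
   ((size s)%:R / m%:R ^+ k.+1)%:E)%E.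
Proof.
move=> m0; have mp : 0 < m%:R :> R by rewrite ltr0n.
have mi (c : 'rV[int]_k.+1) : measurable_fun [set: measurableTypeR R]
    (fun t => (\1_(cell m (c 0 ord0)) t : R)%:E).
  by apply/measurable_EFinP; exact: measurable_indic (measurable_cell _ m0).
under eq_integral => t _ do rewrite size_fiber mulrC EFinM -sumEFin.
rewrite ge0_integralZl //=; last 2 first.
- exact: emeasurable_sum mi.
- by move=> t _; apply: sume_ge0 => c _; rewrite lee_fin indicE.
rewrite ge0_integral_sum //=.
under eq_bigr => c _.
  rewrite integral_indic //=; last exact: measurable_cell.
  rewrite setIT lebesgue_measure_cell //.
  over.
rewrite sumEFin -EFinM big_const_seq count_predT iter_addr_0.
congr EFin; rewrite -mulr_natr exprS; field.
by rewrite mul1r !lt0r_neq0 ?exprn_gt0.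
Qed.

(** Induction on k: the fibre over t of a covering by cubes covers the section of [A] at t, and
    [integral_size_fiber] integrates the resulting bounds. *)
Lemma lebesgue_rV_le (m k : nat) (s : seq 'rV[int]_k) (A : set 'rV[R]_k) :
  (0 < m)%N -> (forall x, A x -> exists2 c, c \in s & cube m c x) ->
  (lebesgue_rV A <= ((size s)%:R / m%:R ^+ k)%:E)%E.
Proof.
move=> m0; elim: k s A => [|k IH] s A sA /=.
  rewrite expr0 divr1 lee_fin indicE; case: (boolP (0 \in A)) => [|_]; last first.
    by rewrite ler0n.
  by rewrite inE => /sA[c]; case: s {sA} => // b s _ _; rewrite ler_nat.
rewrite -integral_size_fiber //; apply: le_integral_nonneg => t.
  exact: lebesgue_rV_ge0.
apply: IH => y /sA[c cs /cubeP[c0 cy]].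
by eexists; last exact: cy; apply: map_f; rewrite mem_filter cs andbT; apply/asboolP.
Qed.

(** Dual to the covering bound. Fibres stay duplicate-free because t determines the first index of
    every cube that it meets. *)
Lemma lebesgue_rV_ge (m k : nat) (s : seq 'rV[int]_k) (A : set 'rV[R]_k) :
  (0 < m)%N -> uniq s -> (forall c x, c \in s -> cube m c x -> A x) ->
  (((size s)%:R / m%:R ^+ k)%:E <= lebesgue_rV A)%E.
Proof.
move=> m0; elim: k s A => [|k IH] s A us sA /=.
  rewrite expr0 divr1 lee_fin indicE.
  case: s us sA => [|b s] us sA; first by rewrite ler0n.
  rewrite mem_set; last by apply: (sA b); [rewrite mem_head | case].
  (* In dimension 0 there is a single row vector, hence at most one cube. *)
  rewrite ler_nat; apply: leq_trans (uniq_leq_size us (s2 := [:: 0]) _) _ => //.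
  by move=> c _; rewrite inE; apply/eqP/rowP; case.
rewrite -integral_size_fiber //; apply: le_integral_nonneg => t.
  by rewrite lee_fin divr_ge0 // ?exprn_ge0.
apply: IH => [|d y].
  rewrite map_inj_in_uniq ?filter_uniq // => c d.
  rewrite !mem_filter => /andP[/asboolP ct _] /andP[/asboolP dt _] /rowP cd.
  apply/rowP => i; case: (unliftP ord0 i) => [j|] ->; last exact: cell_inj ct dt.
  by have := cd j; rewrite !mxE.
move=> /mapP[c]; rewrite mem_filter => /andP[/asboolP ct cs] -> cy.
by apply: (sA c) => //; apply/cubeP.
Qed.

End GridVolume.

(** * Volume as the leading coefficient of a lattice point count *)

Section EhrhartVolume.
Local Open Scope classical_set_scope.
Local Open Scope ring_scope.
Variable R : realType.

Lemma intmx_inj (m n : nat) : injective (@intmx R m n).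
Proof.
move=> A B /matrixP AB; apply/matrixP => i j.
by have := AB i j; rewrite !mxE => /intr_inj.
Qed.

Lemma intmxD (m n : nat) (A B : 'M[int]_(m, n)) : intmx R (A + B) = intmx R A + intmx R B.
Proof. exact: map_mxD. Qed.

Lemma intmxM (m n q : nat) (A : 'M[int]_(m, n)) (B : 'M[int]_(n, q)) :
  intmx R (A *m B) = intmx R A *m intmx R B.
Proof. exact: map_mxM. Qed.

Lemma intmxZ (m n : nat) (a : int) (A : 'M[int]_(m, n)) :
  intmx R (a *: A) = a%:~R *: intmx R A.
Proof. exact: map_mxZ. Qed.

Lemma intmx_const (m n : nat) (a : int) :
  intmx R (const_mx a : 'M[int]_(m, n)) = const_mx a%:~R.
Proof. exact: map_const_mx. Qed.

Lemma cvg_exprn (u : nat -> R) (l : R) (n : nat) :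
  u @ \oo --> l -> (fun m => u m ^+ n) @ \oo --> l ^+ n.
Proof.
move=> ul; elim: n => [|n IH].
  by under eq_fun do rewrite expr0; rewrite expr0; exact: cvg_cst.
by under eq_fun do rewrite exprS; rewrite exprS; exact: cvgM.
Qed.

(** [E] collects the height functions and [L] the facet forms of the cone over [P]; the m-fold
    dilation of [P] is the slice of this cone at height m. *)
Variables (d s : nat) (J : finType) (E : 'M[int]_(d, s)) (L : J -> 'cV[int]_d).
Variables (P : set 'rV[R]_d) (k : nat).
Hypothesis PE : forall x, P x <-> x *m intmx R E = const_mx 1 /\
  forall j, 0 <= (x *m intmx R (L j)) 0 0.
Hypothesis affP : affine_hull P = [set x | x *m intmx R E = const_mx 1].
Variables (p : 'rV[int]_d) (B : 'M[int]_(k, d)).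
Hypothesis chart : lattice_chart P p B.

Lemma chart_origin : p *m E = const_mx 1.
Proof.
have [_ h _] := chart.
have : affine_hull P (intmx R p) by rewrite h; exists 0 => //; rewrite mul0mx addr0.
by rewrite affP /= -intmxM => pE; apply: intmx_inj; rewrite pE intmx_const.
Qed.

Lemma chart_direction : B *m E = 0.
Proof.
have [_ h _] := chart.
apply: intmx_inj; apply/row_matrixP => i; rewrite intmxM row_mul.
have : affine_hull P (intmx R p + delta_mx 0 i *m intmx R B) by rewrite h; exists (delta_mx 0 i).
rewrite affP /= mulmxDl -intmxM chart_origin intmx_const -rowE.
by move/eqP; rewrite -subr_eq0 addrAC subrr add0r => /eqP ->; rewrite /intmx map_mx0 row0.
Qed.

Lemma chart_mulmx_inj (c e : 'rV[int]_k) : c *m B = e *m B -> c = e.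
Proof.
have [rfB _ _] := chart; move=> /(congr1 (@intmx R _ _)); rewrite !intmxM.
by move=> /(row_free_inj rfB) /intmx_inj.
Qed.

(** A chart only speaks of integer points at height 1; subtracting (m - 1) p brings a point from
    height m to that level. *)
Lemma chart_surj (m : int) (z : 'rV[int]_d) : z *m E = const_mx m ->
  exists c : 'rV[int]_k, z = m *: p + c *m B.
Proof.
have [_ _ h] := chart; move=> zE.
have [|c hc] := h (z - (m - 1) *: p).
  rewrite affP /= -intmxM mulmxBl -scalemxAl zE chart_origin.
  rewrite (_ : _ - _ = const_mx 1) ?intmx_const //.
  by apply/matrixP => i j; rewrite !mxE; lia.
exists c; move/eqP: hc; rewrite subr_eq => /eqP ->.
by rewrite addrAC scalerBl scale1r addrC [p + _]addrC subrK addrC.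
Qed.

(** Bounds the variation of a facet form over chart coordinates in [-1, 1]; the sum over all j makes
    the bound uniform in the facet. *)
Let K : nat := \sum_j \sum_i absz ((B *m L j) i 0)%R.

Lemma chart_perturb (j : J) (u : 'rV[R]_k) : (forall i, `|u 0 i| <= 1) ->
  `|(u *m intmx R B *m intmx R (L j)) 0 0| <= K%:R.
Proof.
move=> u1; rewrite -mulmxA -intmxM mxE.
apply: (@le_trans _ _ (\sum_i absz ((B *m L j) i 0)%R)%:R); last first.
  by rewrite ler_nat /K (bigD1 j) //= leq_addr.
rewrite natr_sum; apply: le_trans (ler_norm_sum _ _ _) _; apply: ler_sum => i _.
rewrite normrM; have -> : (absz ((B *m L j) i 0)%R)%:R = `|intmx R (B *m L j) i 0|.
  by rewrite [intmx _ _ _ _]mxE -intr_norm natr_absz.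
by rewrite ler_piMl.
Qed.

(** The dilated point and the lattice point that indexes its cube differ by u B, where u = m x - c
    has entries in [0, 1). *)
Lemma cube_perturb (m : nat) (c : 'rV[int]_k) (x : 'rV[R]_k) (j : J) :
  cube m c x ->
  `|m%:R * ((intmx R p + x *m intmx R B) *m intmx R (L j)) 0 0
    - (((m%:Z *: p + c *m B) *m L j) 0 0)%:~R| <= K%:R.
Proof.
move=> cx; set u := m%:R *: x - intmx R c.
suff -> : m%:R * ((intmx R p + x *m intmx R B) *m intmx R (L j)) 0 0
    - (((m%:Z *: p + c *m B) *m L j) 0 0)%:~R = (u *m intmx R B *m intmx R (L j)) 0 0.
  apply: chart_perturb => i; rewrite !mxE.
  by have /andP[h1 h2] := cx i; rewrite ler_norml; apply/andP; split; lra.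
have -> : (((m%:Z *: p + c *m B) *m L j) 0 0)%:~R =
  ((m%:R *: intmx R p + intmx R c *m intmx R B) *m intmx R (L j)) 0 0.
  by rewrite -intmxM -(intmxZ m%:Z) -intmxD -intmxM [in RHS]mxE.
have -> : m%:R * ((intmx R p + x *m intmx R B) *m intmx R (L j)) 0 0 =
  ((m%:R *: (intmx R p + x *m intmx R B)) *m intmx R (L j)) 0 0.
  by rewrite -scalemxAl [in RHS]mxE.
have -> (y z : 'M[R]_1) : y 0 0 - z 0 0 = (y - z) 0 0 by rewrite !mxE.
rewrite -mulmxBl; congr ((_ *m _) 0 0).
by rewrite scalerDr opprD addrACA subrr add0r /u mulmxBl scalemxAl.
Qed.

(** An interior lattice point of the cone: every facet form is at least 1 on it, so adding K z0
    absorbs an error of size K, at the cost of raising the height by a = K n0. *)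
Variables (z0 : 'rV[int]_d) (n0 : nat).
Hypothesis z0E : z0 *m E = const_mx n0%:Z.
Hypothesis z0L : forall j, 1 <= (z0 *m L j) 0 0.

Variable pts : nat -> seq 'rV[int]_d.
Hypothesis pts_uniq : forall m, uniq (pts m).
Hypothesis ptsP : forall m z, z \in pts m <->
  z *m E = const_mx m%:Z /\ forall j, 0 <= (z *m L j) 0 0.

Lemma eval_shift (z : 'rV[int]_d) (b : int) (j : J) :
  ((z + b *: z0) *m L j) 0 0 = (z *m L j) 0 0 + b * (z0 *m L j) 0 0.
Proof. by rewrite mulmxDl -scalemxAl mxE; congr (_ + _); rewrite mxE. Qed.

Let vol := lebesgue_rV [set x : 'rV[R]_k | P (intmx R p + x *m intmx R B)].
Let a : nat := (K * n0)%N.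

Lemma chart_point (x : 'rV[R]_k) :
  P (intmx R p + x *m intmx R B) <->
  forall j, 0 <= ((intmx R p + x *m intmx R B) *m intmx R (L j)) 0 0.
Proof.
split=> [/PE[] //|h]; apply/PE; split=> //.
rewrite mulmxDl -mulmxA -!intmxM chart_origin chart_direction intmx_const.
by rewrite /intmx map_mx0 mulmx0 addr0.
Qed.

(** A point of the region lies in the cube indexed by the floors of m x. Facet forms are at least -K
    at the lattice point of that cube, so adding K z0 moves it into the dilation of order m + a. *)
Lemma vol_le (m : nat) : (0 < m)%N ->
  (vol <= ((size (pts (m + a)))%:R / m%:R ^+ k)%:E)%E.
Proof.
move=> m0; have mp : 0 < m%:R :> R by rewrite ltr0n.
(* [g] inverts the chart at height m. *)
have /choice[g gP] : forall z, exists c, z *m E = const_mx m%:Z -> z = m%:Z *: p + c *m B.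
  move=> z; have [/chart_surj[c hc]|h] := pselect (z *m E = const_mx m%:Z); first by exists c.
  by exists 0 => /h.
rewrite -(size_map (fun z => g (z - K%:Z *: z0))); apply: lebesgue_rV_le => //= x /chart_point Px.
pose c : 'rV[int]_k := \row_i Num.floor (m%:R * x 0 i).
have cx : cube m c x.
  move=> i; rewrite /cell /= mxE; have := Num.Theory.floor_itv (m%:R * x 0 i).
  by rewrite intrD.
exists c => //; pose z := m%:Z *: p + c *m B.
have zE : z *m E = const_mx m%:Z.
  rewrite mulmxDl -mulmxA chart_direction mulmx0 addr0 -scalemxAl chart_origin.
  by apply/matrixP => i j; rewrite !mxE mulr1.
have -> : c = g (z + K%:Z *: z0 - K%:Z *: z0).
  by rewrite addrK; apply: chart_mulmx_inj; have /addrI := gP z zE.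
apply: (map_f (fun z => g (z - K%:Z *: z0))); apply/ptsP; split => [|j].
  rewrite mulmxDl zE -scalemxAl z0E; apply/matrixP => i j; rewrite !mxE.
  by rewrite /a PoszD PoszM.
have := cube_perturb j cx; rewrite ler_norml => /andP[_ h].
have {h} : - K%:Z <= (z *m L j) 0 0.
  rewrite -(ler_int R) rmorphN /=; have := mulr_ge0 (ltW mp) (Px j); rewrite /z; lra.
have := ler_wpM2l (isT : 0 <= K%:Z) (z0L j).
rewrite eval_shift mulr1; lia.
Qed.

(** Shifting a lattice point of the m-fold dilation by K z0 makes all facet forms at least K, so the
    whole cube of mesh 1/(m + a) that it indexes lies in the region. *)
Lemma vol_ge (m : nat) : (0 < m)%N ->
  (((size (pts m))%:R / (m + a)%:R ^+ k)%:E <= vol)%E.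
Proof.
move=> m0; set M := (m + a)%N; have M0 : (0 < M)%N by rewrite addn_gt0 m0.
have Mp : 0 < M%:R :> R by rewrite ltr0n.
have /choice[g gP] : forall z, exists c, z *m E = const_mx M%:Z -> z = M%:Z *: p + c *m B.
  move=> z; have [/chart_surj[c hc]|h] := pselect (z *m E = const_mx M%:Z); first by exists c.
  by exists 0 => /h.
have shiftE z : z \in pts m -> (z + K%:Z *: z0) *m E = const_mx M%:Z.
  move=> /ptsP[zE _]; rewrite mulmxDl zE -scalemxAl z0E; apply/matrixP => i j; rewrite !mxE.
  by rewrite /M /a PoszD PoszM.
rewrite -(size_map (fun z => g (z + K%:Z *: z0))); apply: lebesgue_rV_ge => //.
  rewrite map_inj_in_uniq // => y z ym zm gyz.
  by apply: (@addIr _ (K%:Z *: z0)); rewrite (gP _ (shiftE _ ym)) (gP _ (shiftE _ zm)) gyz.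
move=> _ x /mapP[z zm ->] cx; apply/chart_point => j.
have := cube_perturb j cx; rewrite -(gP _ (shiftE _ zm)) ler_norml => /andP[h _].
have {}h2 : K%:Z <= ((z + K%:Z *: z0) *m L j) 0 0.
  have /ptsP[_ /(_ j)] := zm; have := ler_wpM2l (isT : 0 <= K%:Z) (z0L j).
  rewrite eval_shift mulr1; lia.
rewrite -(pmulr_rge0 _ Mp).
have : K%:R <= (((z + K%:Z *: z0) *m L j) 0 0)%:~R :> R by rewrite -(ler_int R) in h2.
by move: h; lra.
Qed.

Lemma cvg_ratio_shift (b : nat) :
  (fun m : nat => (m%:R / (m + b)%:R : R) ^+ k) @ \oo --> (1 : R).
Proof.
have := @cvg_exprn (fun m => m%:R / (m + b)%:R) 1 k.
rewrite expr1n; apply; rewrite -cvg_shiftS /=.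
have -> : (fun m : nat => m.+1%:R / (m.+1 + b)%:R : R) =
          (fun m : nat => 1 - b%:R * ((m + b).+1)%:R^-1).
  apply/funext => m; have : m.+1%:R + b%:R != 0 :> R by rewrite -natrD pnatr_eq0.
  by rewrite -addSn natrD => h; field.
suff : (fun m : nat => 1 - b%:R * (m + b).+1%:R^-1 : R) @ \oo --> (1 - b%:R * 0 : R).
  by rewrite mulr0 subr0.
apply: cvgB; [exact: cvg_cst | apply: cvgM; first exact: cvg_cst].
have -> : (fun m => (m + b).+1%:R^-1 : R) = [sequence (@harmonic R) (m + b)%N]_m by [].
by rewrite cvg_shiftn; exact: cvg_harmonic.
Qed.

(** Squeeze: the volume lies between #pts(m) / (m + a)^k and #pts(m + a) / m^k, and both tend to c
    because (m / (m + a))^k tends to 1. *)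
Lemma chart_volume (c : R) :
  (fun m => (size (pts m))%:R / m%:R ^+ k : R) @ \oo --> c -> vol = c%:E.
Proof.
move=> hc.
have vfin : vol \is a fin_num.
  rewrite ge0_fin_numE; last exact: lebesgue_rV_ge0.
  exact: le_lt_trans (vol_le (ltn0Sn 0)) (ltry _).
rewrite -(fineK vfin); congr EFin; apply/eqP; rewrite eq_le; apply/andP; split.
- have : (fun m => ((size (pts (m + a)))%:R / (m + a)%:R ^+ k) *
                   ((m%:R / (m + a)%:R) ^+ k)^-1 : R) @ \oo --> c.
    have -> : c = c * 1^-1 by rewrite invr1 mulr1.
    apply: cvgM; last by apply: cvgV; [rewrite oner_eq0 | exact: cvg_ratio_shift].
    by rewrite (cvg_shiftn a (fun m => (size (pts m))%:R / m%:R ^+ k : R)).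
  move=> h; apply: (ler_cvg_to (cvg_cst (fine vol)) h); exists 1%N => // m /= m0.
  have := vol_le m0; rewrite -{1}(fineK vfin) lee_fin => /le_trans; apply.
  rewrite le_eqVlt; apply/orP; left; apply/eqP.
  by rewrite expr_div_n invf_div mulrA divfK // expf_neq0 // pnatr_eq0; lia.
- have : (fun m => ((size (pts m))%:R / m%:R ^+ k) *
                   ((m%:R / (m + a)%:R) ^+ k) : R) @ \oo --> c.
    by rewrite -[c]mulr1; apply: cvgM => //; exact: cvg_ratio_shift.
  move=> h; apply: (ler_cvg_to h (cvg_cst (fine vol))); exists 1%N => // m /= m0.
  have := vol_ge m0; rewrite -{1}(fineK vfin) lee_fin; apply: le_trans.
  rewrite le_eqVlt; apply/orP; left; apply/eqP.
  by rewrite expr_div_n mulrA divfK // expf_neq0 // pnatr_eq0; lia.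
Qed.

End EhrhartVolume.

(** * Double series and leading coefficients *)

Section DoubleSeries.
Local Open Scope ring_scope.

(** Coefficient arrays of formal power series in x and y. The operators [shiftx], [shifty], [shiftd]
    are multiplication by x, y, xy, then [sumx], [sumy], [sumd] are multiplication by X, Y, Z, and
    [dconv] is the product. *)
Definition dseries := nat -> nat -> int.
Implicit Types f g u : dseries.

Definition shiftx f : dseries := fun a b => if a is a'.+1 then f a' b else 0.
Definition shifty f : dseries := fun a b => if b is b'.+1 then f a b' else 0.
Definition shiftd f : dseries := shiftx (shifty f).

Definition sumx f : dseries := fun a b => \sum_(i < a.+1) f i b.
Definition sumy f : dseries := fun a b => \sum_(j < b.+1) f a j.
Definition sumd f : dseries := fun a b => \sum_(i < (minn a b).+1) f (a - i)%N (b - i)%N.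

Definition delta : dseries := fun a b => ((a == 0%N) && (b == 0%N))%:Z.

Definition dconv g f : dseries := fun a b =>
  \sum_(i < a.+1) \sum_(j < b.+1) g i j * f (a - i)%N (b - j)%N.

Lemma sumx_rec f : sumx f = f + shiftx (sumx f).
Proof.
apply/funext => -[|a]; apply/funext => b; rewrite !fctE /sumx /=.
  by rewrite big_ord_recl big_ord0.
by rewrite big_ord_recr /= addrC.
Qed.

Lemma sumy_rec f : sumy f = f + shifty (sumy f).
Proof.
apply/funext => a; apply/funext => -[|b]; rewrite !fctE /sumy /=.
  by rewrite big_ord_recl big_ord0.
by rewrite big_ord_recr /= addrC.
Qed.

Lemma sumd_rec f : sumd f = f + shiftd (sumd f).
Proof.
apply/funext => a; apply/funext => b; rewrite !fctE /sumd /shiftd /shiftx /shifty.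
case: a => [|a]; first by rewrite min0n big_ord_recl big_ord0 /= !subn0.
case: b => [|b]; first by rewrite minn0 big_ord_recl big_ord0 /= !subn0.
by rewrite minnSS big_ord_recl !subn0; congr (_ + _); apply: eq_bigr => i _; rewrite !subSS.
Qed.

(** The equation (1 - x) u = f determines u coefficient by coefficient. This and its two analogues
    turn commutation rules and closed forms into checks of a recurrence. *)
Lemma sumx_unique u f : u = f + shiftx u -> u = sumx f.
Proof.
move=> uE; apply/funext; elim=> [|a IH]; rewrite uE sumx_rec; apply/funext => b; rewrite !fctE //=.
by rewrite IH.
Qed.

Lemma sumy_unique u f : u = f + shifty u -> u = sumy f.
Proof.
move=> uE; apply/funext => a; apply/funext; elim=> [|b IH]; rewrite uE sumy_rec !fctE //=.
by rewrite IH.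
Qed.

Lemma sumd_unique u f : u = f + shiftd u -> u = sumd f.
Proof.
move=> uE; apply/funext; elim=> [|a IH]; rewrite uE sumd_rec;
  apply/funext => -[|b]; rewrite !fctE //=.
by rewrite /shiftd /= IH.
Qed.

Lemma sumxD f g : sumx (f + g) = sumx f + sumx g.
Proof. by apply/funext => a; apply/funext => b; rewrite /sumx !fctE -big_split. Qed.
Lemma sumyD f g : sumy (f + g) = sumy f + sumy g.
Proof. by apply/funext => a; apply/funext => b; rewrite /sumy !fctE -big_split. Qed.
Lemma sumxN f : sumx (- f) = - sumx f.
Proof. by apply/funext => a; apply/funext => b; rewrite /sumx !fctE sumrN. Qed.
Lemma sumyN f : sumy (- f) = - sumy f.
Proof. by apply/funext => a; apply/funext => b; rewrite /sumy !fctE sumrN. Qed.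

Lemma sumxy f : sumx (sumy f) = sumy (sumx f).
Proof. by apply/funext => a; apply/funext => b; exact: exchange_big. Qed.

Lemma sumx_shiftd f : sumx (shiftd f) = shiftd (sumx f).
Proof.
apply/funext => -[|a]; apply/funext => -[|b]; rewrite /sumx /shiftd /shiftx /shifty.
- by rewrite big_ord_recl big_ord0.
- by rewrite big_ord_recl big_ord0.
- by rewrite big1 // => -[[|i] hi].
- by rewrite big_ord_recl add0r.
Qed.

Lemma sumy_shiftd f : sumy (shiftd f) = shiftd (sumy f).
Proof.
apply/funext => -[|a]; apply/funext => -[|b]; rewrite /sumy /shiftd /shiftx /shifty.
- by rewrite big_ord_recl big_ord0.
- by rewrite big1.
- by rewrite big_ord_recl big_ord0.
- by rewrite big_ord_recl add0r.
Qed.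

Lemma sumxd f : sumx (sumd f) = sumd (sumx f).
Proof. by apply: sumd_unique; rewrite {1}sumd_rec sumxD sumx_shiftd. Qed.

Lemma sumyd f : sumy (sumd f) = sumd (sumy f).
Proof. by apply: sumd_unique; rewrite {1}sumd_rec sumyD sumy_shiftd. Qed.

Lemma dconvDl g1 g2 f : dconv (g1 + g2) f = dconv g1 f + dconv g2 f.
Proof.
apply/funext => a; apply/funext => b; rewrite /dconv !fctE -big_split; apply: eq_bigr => i _.
by rewrite -big_split; apply: eq_bigr => j _; rewrite mulrDl.
Qed.

Lemma dconvNl g f : dconv (- g) f = - dconv g f.
Proof.
apply/funext => a; apply/funext => b; rewrite /dconv !fctE -sumrN; apply: eq_bigr => i _.
by rewrite -sumrN; apply: eq_bigr => j _; rewrite mulNr.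
Qed.

Lemma dconv_shiftx g f : dconv (shiftx g) f = shiftx (dconv g f).
Proof.
apply/funext => -[|a]; apply/funext => b; rewrite /dconv /=.
  by rewrite big_ord_recl big_ord0 addr0 big1 // => j _; rewrite mul0r.
by rewrite big_ord_recl /= big1 ?add0r // => j _; rewrite mul0r.
Qed.

Lemma dconv_shifty g f : dconv (shifty g) f = shifty (dconv g f).
Proof.
apply/funext => a; apply/funext => -[|b]; rewrite /dconv /=.
  by rewrite big1 // => i _; rewrite big_ord_recl big_ord0 addr0 mul0r.
by apply: eq_bigr => i _; rewrite big_ord_recl /= mul0r add0r.
Qed.

Lemma dconv_sumx g f : dconv (sumx g) f = sumx (dconv g f).
Proof. by apply: sumx_unique; rewrite {1}sumx_rec dconvDl dconv_shiftx. Qed.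

Lemma dconv_sumy g f : dconv (sumy g) f = sumy (dconv g f).
Proof. by apply: sumy_unique; rewrite {1}sumy_rec dconvDl dconv_shifty. Qed.

Lemma dconv_sumd g f : dconv (sumd g) f = sumd (dconv g f).
Proof. by apply: sumd_unique; rewrite {1}sumd_rec dconvDl /shiftd dconv_shiftx dconv_shifty. Qed.

Lemma dconv_delta f : dconv delta f = f.
Proof.
apply/funext => a; apply/funext => b; rewrite /dconv big_ord_recl big_ord_recl !subn0 mul1r.
rewrite !big1 ?addr0 // => [i _|i _]; last by rewrite mul0r.
by rewrite big1 // => j _; rewrite mul0r.
Qed.

(* Number of triples of naturals with sum [i] and first entry at most [j]. *)
Definition ntriples (i j : nat) : nat := \sum_(k < (minn i j).+1) (i - k).+1.

(* In a block with left sum [i] and right sum [j], the facet inequalities say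
   that the entry of the new vertex is at most [j] on the left and at most [i]
   on the right. *)
Definition gadget : dseries := fun i j => (ntriples i j * ntriples j i)%N%:Z.

(** The series X Y^2, X^2 Y and X^2 Y^2, in this order. *)
Let U : dseries := fun i j => j.+1%:Z.
Let W : dseries := fun i j => i.+1%:Z.
Let E : dseries := fun i j => (i.+1 * j.+1)%N%:Z.

Lemma sumxy_delta : sumx (sumy delta) = fun _ _ => 1.
Proof.
apply/funext => a; apply/funext => b; rewrite /sumx /sumy big_ord_recl big_ord_recl.
rewrite !big1 ?addr0 // => i _; rewrite ?big1 // => j _; by rewrite /delta andbF.
Qed.

Lemma sumx_one (c : nat -> int) : sumx (fun _ => c) = fun a b => a.+1%:Z * c b.
Proof.
apply/funext => a; apply/funext => b; rewrite /sumx sumr_const card_ord.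
by rewrite -mulr_natl natz.
Qed.

Lemma sumy_one (c : nat -> int) : sumy (fun a _ => c a) = fun a b => b.+1%:Z * c a.
Proof.
apply/funext => a; apply/funext => b; rewrite /sumy sumr_const card_ord.
by rewrite -mulr_natl natz.
Qed.

Lemma U_delta : U = sumx (sumy (sumy delta)).
Proof.
rewrite sumxy sumxy_delta (sumy_one (fun _ => 1)).
by apply/funext => a; apply/funext => b; rewrite mulr1.
Qed.

Lemma W_delta : W = sumx (sumx (sumy delta)).
Proof.
rewrite sumxy_delta (sumx_one (fun _ => 1)).
by apply/funext => a; apply/funext => b; rewrite mulr1.
Qed.

Lemma E_delta : E = sumx (sumx (sumy (sumy delta))).
Proof.
rewrite -U_delta (sumx_one (fun b => b.+1%:Z)).
by apply/funext => a; apply/funext => b; rewrite /E PoszM.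
Qed.

(** Removing the entry k of the new vertex lowers both indices by k, which gives the series Z X^2
    Y. *)
Lemma ntriplesl : (fun i j => (ntriples i j)%:Z) = sumd W.
Proof.
apply/funext => i; apply/funext => j; rewrite /ntriples /sumd /W.
by rewrite (big_morph Posz PoszD (erefl 0)).
Qed.

Lemma ntriplesr : (fun i j => (ntriples j i)%:Z) = sumd U.
Proof.
apply/funext => i; apply/funext => j; rewrite /ntriples /sumd /U minnC.
by rewrite (big_morph Posz PoszD (erefl 0)).
Qed.

Lemma ntriples0n i : ntriples 0 i = 1%N.
Proof. by rewrite /ntriples min0n big_ord_recl big_ord0. Qed.
Lemma ntriplesn0 i : ntriples i 0 = i.+1.
Proof. by rewrite /ntriples minn0 big_ord_recl big_ord0 subn0 addn0. Qed.
Lemma ntriplesSS i j : ntriples i.+1 j.+1 = (i.+2 + ntriples i j)%N.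
Proof.
by rewrite /ntriples minnSS big_ord_recl subn0; congr addn; apply: eq_bigr => k _; rewrite subSS.
Qed.

(** The gadget is a termwise product of P(i,j) = [ntriples i j] and Q(i,j) = [ntriples j i]. Since
    P(i+1,j+1) = i + 2 + P(i,j), and symmetrically for Q, multiplying PQ by 1 - xy leaves (i+1) Q +
    (j+1) P - (i+1)(j+1). The same device is applied to the first two terms, in [hU] and [hW]. *)
Lemma gadget_rec : gadget =
  sumd (sumd (sumd U + E - U) + sumd (sumd W + E - W) - E).
Proof.
have hU : (fun i j => (i.+1 * ntriples j i)%N%:Z) = sumd (sumd U + E - U).
  apply: sumd_unique; rewrite -ntriplesr; apply/funext => -[|i]; apply/funext => -[|j];
  rewrite /shiftd /U /E !fctE /= ?ntriplesSS ?ntriples0n ?ntriplesn0; lia.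
have hW : (fun i j => (j.+1 * ntriples i j)%N%:Z) = sumd (sumd W + E - W).
  apply: sumd_unique; rewrite -ntriplesl; apply/funext => -[|i]; apply/funext => -[|j];
  rewrite /shiftd /W /E !fctE /= ?ntriplesSS ?ntriples0n ?ntriplesn0; lia.
rewrite -hU -hW; apply: sumd_unique; apply/funext => -[|i]; apply/funext => -[|j];
  rewrite /gadget /shiftd /U /W /E !fctE /= ?ntriplesSS ?ntriples0n ?ntriplesn0; lia.
Qed.

Lemma dconv_gadget f (fU := sumx (sumy (sumy f))) (fW := sumx (sumx (sumy f)))
    (fE := sumx (sumx (sumy (sumy f)))) :
  dconv gadget f = sumd (sumd (sumd fU + fE - fU) + sumd (sumd fW + fE - fW) - fE).
Proof.
rewrite gadget_rec U_delta W_delta E_delta.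
by rewrite !(dconv_sumd, dconvDl, dconvNl, dconv_sumx, dconv_sumy, dconv_delta).
Qed.

End DoubleSeries.

(** * Leading coefficients along the diagonal *)

Section LeadingCoefficient.
Local Open Scope ring_scope.

(* In the basis of the polynomials 'C(m + j, j), taking partial sums of [f]
   shifts the coordinates by one. *)
Definition lead (k : nat) (c : int) (f : nat -> int) : Prop :=
  exists r : nat -> int, forall m,
    f m = c * 'C(m + k, k)%:Z + \sum_(j < k) r j * 'C(m + j, j)%:Z.

Lemma lead_binomial (k : nat) : lead k 1 (fun m => 'C(m + k, k)%:Z).
Proof. by exists (fun=> 0) => m; rewrite mul1r big1 ?addr0 // => j _; rewrite mul0r. Qed.

Lemma leadD k c c' f f' : lead k c f -> lead k c' f' -> lead k (c + c') (f + f').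
Proof.
move=> [r hr] [r' hr']; exists (r + r') => m; rewrite !fctE hr hr' mulrDl addrACA; congr (_ + _).
by rewrite -big_split; apply: eq_bigr => j _; rewrite mulrDl.
Qed.

Lemma leadN k c f : lead k c f -> lead k (- c) (- f).
Proof.
move=> [r hr]; exists (- r) => m; rewrite !fctE hr mulNr opprD; congr (_ + _).
by rewrite -sumrN; apply: eq_bigr => j _; rewrite mulNr.
Qed.

Lemma lead_up k c f : lead k c f -> lead k.+1 0 f.
Proof.
move=> [r hr]; exists (fun j => if j == k then c else r j) => m.
rewrite hr mul0r add0r big_ord_recr /= eqxx addrC; congr (_ + _); apply: eq_bigr => j _.
by rewrite ltn_eqF.
Qed.

Lemma sum_binomial (k m : nat) : (\sum_(i < m.+1) 'C(i + k, k) = 'C(m + k.+1, k.+1))%N.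
Proof.
elim: m => [|m IH]; first by rewrite big_ord_recl big_ord0 !binn.
by rewrite big_ord_recr /= IH [in RHS]addSn binS addSnnS.
Qed.

Lemma lead_sum k c f : lead k c f -> lead k.+1 c (fun m => \sum_(i < m.+1) f i).
Proof.
move=> [r hr]; exists (fun j => if j is j'.+1 then r j' else 0) => m.
under eq_bigr do rewrite hr.
rewrite big_split /= -mulr_sumr exchange_big [in RHS]big_ord_recl mul0r add0r.
have h j : \sum_(i < m.+1) 'C(i + j, j)%:Z = 'C(m + j.+1, j.+1)%:Z.
  by rewrite -sum_binomial (big_morph Posz PoszD (erefl 0)).
by rewrite h; congr (_ + _); apply: eq_bigr => j _; rewrite -mulr_sumr h.
Qed.

(** Write b(p,q) for the product. The difference of b(p+1,q+1) at consecutive arguments is b(p,q+1)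
    + b(p+1,q) - b(p,q); the last term has lower degree, and the coefficients of the first two add
    up by Pascal's rule. *)
Lemma lead_binomialM (p q : nat) :
  lead (p + q) 'C(p + q, p)%:Z (fun m => ('C(m + p, p) * 'C(m + q, q))%N%:Z).
Proof.
have [n] := ubnP (p + q); elim: n p q => // n IH [|p] [|q] pqn.
- rewrite addn0 bin0; under eq_fun do rewrite !bin0 muln1.
  by have := lead_binomial 0; under eq_fun do rewrite bin0.
- by rewrite bin0; under eq_fun do rewrite bin0 mul1n; exact: lead_binomial.
- by rewrite addn0 binn; under eq_fun do rewrite bin0 muln1; exact: lead_binomial.
rewrite addSn !ltnS in pqn *.
pose b p q m : int := ('C(m + p, p) * 'C(m + q, q))%N%:Z.
have -> : (fun m => b p.+1 q.+1 m) =
    (fun m => \sum_(i < m.+1) (b p q.+1 + b p.+1 q - b p q) i).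
  apply/funext; elim=> [|m IHm]; first by rewrite big_ord_recl big_ord0 !fctE /b !add0n !binn.
  have step k : 'C(m.+1 + k.+1, k.+1) = ('C(m + k.+1, k.+1) + 'C(m.+1 + k, k))%N.
    by rewrite [in LHS]addSn binS addSnnS.
  by rewrite big_ord_recr /= -IHm !fctE /b !step !PoszM !PoszD; ring.
rewrite addnS binS PoszD -[_ + _]subr0; apply: lead_sum; apply: leadD; last first.
  by apply: leadN; apply: lead_up; apply: IH; lia.
rewrite addrC; apply: leadD; last by rewrite -addSn; apply: IH; lia.
by rewrite -addnS; apply: IH; lia.
Qed.

Definition central (f : dseries) : nat -> int := fun m => f m m.

(** Multiplication by Z keeps each diagonal to itself, so on the main diagonal it is plain partial
    summation. *)
Lemma lead_central_sumd k c f : lead k c (central f) -> lead k.+1 c (central (sumd f)).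
Proof.
move/lead_sum; congr lead; apply/funext => m; rewrite /central /sumd minnn.
rewrite [RHS](reindex_inj rev_ord_inj) /=; apply: eq_bigr => i _.
by rewrite subSS subKn // -ltnS.
Qed.

Lemma lead_centralD k c c' (f g : dseries) :
  lead k c (central f) -> lead k c' (central g) -> lead k (c + c') (central (f + g)).
Proof. exact: leadD. Qed.

Lemma lead_centralN k c (f : dseries) : lead k c (central f) -> lead k (- c) (central (- f)).
Proof. exact: leadN. Qed.

(** The series X^p Y^q times the r-th power of the gadget. *)
Definition nconfig (p q r : nat) : dseries :=
  iter p sumx (iter q sumy (iter r (dconv gadget) delta)).

Lemma iter_sumxD p f g : iter p sumx (f + g) = iter p sumx f + iter p sumx g.
Proof. by elim: p => //= p ->; rewrite sumxD. Qed.
Lemma iter_sumyD p f g : iter p sumy (f + g) = iter p sumy f + iter p sumy g.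
Proof. by elim: p => //= p ->; rewrite sumyD. Qed.
Lemma iter_sumxN p f : iter p sumx (- f) = - iter p sumx f.
Proof. by elim: p => //= p ->; rewrite sumxN. Qed.
Lemma iter_sumyN p f : iter p sumy (- f) = - iter p sumy f.
Proof. by elim: p => //= p ->; rewrite sumyN. Qed.
Lemma iter_sumxd p f : iter p sumx (sumd f) = sumd (iter p sumx f).
Proof. by elim: p => //= p ->; rewrite sumxd. Qed.
Lemma iter_sumyd p f : iter p sumy (sumd f) = sumd (iter p sumy f).
Proof. by elim: p => //= p ->; rewrite sumyd. Qed.
Lemma iter_sumyx p f : iter p sumy (sumx f) = sumx (iter p sumy f).
Proof. by elim: p => //= p ->; rewrite sumxy. Qed.

(** One gadget is traded for factors X, Y and Z, the induction step for the growth of [nconfig]. *)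
Lemma config_gadget p q r (fU := nconfig p.+1 q.+2 r) (fW := nconfig p.+2 q.+1 r)
    (fE := nconfig p.+2 q.+2 r) :
  nconfig p q r.+1 = sumd (sumd (sumd fU + fE - fU) + sumd (sumd fW + fE - fW) - fE).
Proof.
rewrite /nconfig iterS dconv_gadget /fU /fW /fE /nconfig.
rewrite !(iter_sumyd, iter_sumyD, iter_sumyN, iter_sumxd, iter_sumxD, iter_sumxN, iter_sumyx).
by rewrite -!iterSr.
Qed.

Lemma config0 p q : nconfig p.+1 q.+1 0 = fun a b => ('C(a + p, p) * 'C(b + q, q))%N%:Z.
Proof.
have hy n : iter n.+1 sumy delta = fun a b => (a == 0%N)%:Z * 'C(b + n, n)%:Z.
  elim: n => [|n IH].
    apply/funext => a; apply/funext => b; rewrite /= /sumy big_ord_recl big1 ?addr0.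
      by rewrite bin0 mulr1 /delta andbT.
    by move=> i _; rewrite /delta andbF.
  rewrite iterS IH; apply/funext => a; apply/funext => b; rewrite /sumy -mulr_sumr.
  by rewrite -sum_binomial (big_morph Posz PoszD (erefl 0)).
rewrite /nconfig hy; elim: p => [|p IH].
  apply/funext => a; apply/funext => b; rewrite /= /sumx big_ord_recl big1 ?addr0.
    by rewrite bin0 mul1n mul1r.
  by move=> i _; rewrite mul0r.
rewrite iterS IH; apply/funext => a; apply/funext => b; rewrite /sumx.
rewrite -sum_binomial PoszM (big_morph Posz PoszD (erefl 0)) mulr_suml.
by apply: eq_bigr => i _; rewrite PoszM.
Qed.

(* The leading coefficients of [fU], [fW] and [fE] in [config_gadget] satisfy
   cU + cW = cE by Pascal's rule, so a gadget multiplies cE by 3. *)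
Lemma lead_config p q r k n l :
  (p + q + 6 * r = k.+2)%N -> (p + q + 4 * r = n.+2)%N -> (p + 2 * r = l.+1)%N -> (l <= n)%N ->
  lead k (3 ^ r * 'C(n, l))%N%:Z (central (nconfig p q r)).
Proof.
(* A gadget weighs 6 in the degree [k], as Z^2 X^2 Y^2 and Z^3 X Y^2 do, but only 4 in [n] and 2 in
   [l], the contribution of X^2 Y^2 alone. *)
elim: r p q k n l => [|r IH] p q k n l hk hn hl ln.
  case: p hk hn hl => [|p]; first by lia.
  case: q => [|q] hk hn hl; first by lia.
  rewrite config0 mul1n; have -> : k = (p + q)%N by lia.
  have -> : n = (p + q)%N by lia. have -> : l = p by lia.
  exact: lead_binomialM.
case: k hk => [|[|[|k]]] hk; try lia.
case: n hn ln => [|n] hn ln; first lia.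
case: l hl ln => [|l] hl ln; first lia.
rewrite config_gadget.
set fU := nconfig p.+1 _ _; set fW := nconfig _ q.+1 _; set fE := nconfig _ _ _.
set cE := (3 ^ r * 'C(n.+1, l.+1))%N%:Z; pose cU := (3 ^ r * 'C(n, l))%N%:Z.
pose cW := (3 ^ r * 'C(n, l.+1))%N%:Z.
have lU : lead k cU (central fU) by apply: IH; lia.
have lE : lead k.+1 cE (central fE) by apply: IH; lia.
have lW : lead k cW (central fW).
  have [ln'|ln'] := leqP l.+1 n; first by apply: IH; lia.
  (* Here l = n would contradict n - l + 1 = q + 2 (r + 1). *)
  lia.
(* The zeros are the contributions of the subtracted series, whose degree is one too low. *)
have -> : (3 ^ r.+1 * 'C(n.+1, l.+1))%N%:Z = (cU + cE - 0) + (cW + cE - 0) - 0.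
  by rewrite /cU /cE /cW expnS binS; lia.
apply: lead_central_sumd; apply: lead_centralD; last first.
  by apply: lead_centralN; apply: lead_up lE.
apply: lead_centralD; apply: lead_central_sumd;
  apply: lead_centralD.
- by apply: lead_centralD => //; exact: lead_central_sumd.
- by apply: lead_centralN; apply: lead_up lU.
- by apply: lead_centralD => //; exact: lead_central_sumd.
- by apply: lead_centralN; apply: lead_up lW.
Qed.

End LeadingCoefficient.

(** * Limits of normalized counts *)

Section LeadingLimit.
Local Open Scope classical_set_scope.
Local Open Scope ring_scope.
Variable R : realType.

(** Induction through (k+1) 'C(m+k+1, k+1) = (m+k+1) 'C(m+k, k), where (m+k+1)/m tends to 1. *)
Lemma cvg_binomial (k : nat) :
  (fun m : nat => 'C(m + k, k)%:R / m%:R ^+ k : R) @ \oo --> (k`!%:R^-1 : R).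
Proof.
elim: k => [|k IH].
  under eq_fun do rewrite bin0 expr0 divr1.
  by rewrite fact0 invr1; exact: cvg_cst.
have h : (fun m : nat => ('C(m + k, k)%:R / m%:R ^+ k) * (k.+1%:R^-1 *
    ((m%:R / (m + k.+1)%:R : R) ^+ 1)^-1)) @ \oo --> (k`!%:R^-1 * (k.+1%:R^-1 * 1^-1) : R).
  apply: cvgM => //; apply: cvgM; first exact: cvg_cst.
  by apply: cvgV; [rewrite oner_eq0 | exact: cvg_ratio_shift].
have -> : (k.+1)`!%:R^-1 = k`!%:R^-1 * (k.+1%:R^-1 * 1^-1) :> R.
  by rewrite factS natrM invfM invr1 mulr1 mulrC.
rewrite -cvg_shiftS; rewrite -cvg_shiftS in h; apply: cvg_trans h.
apply: near_eq_cvg; near=> m => /=.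
have m0 : m.+1%:R != 0 :> R by rewrite pnatr_eq0.
have mk0 : (m.+1 + k.+1)%:R != 0 :> R by rewrite pnatr_eq0.
have k0 : k.+1%:R != 0 :> R by rewrite pnatr_eq0.
have -> : 'C(m.+1 + k.+1, k.+1)%:R = (m.+1 + k.+1)%:R * 'C(m.+1 + k, k)%:R / k.+1%:R :> R.
  by apply: (mulIf k0); rewrite divfK // -!natrM addnS [in LHS]mulnC -mul_bin_diag.
rewrite expr1 exprS; move: m0 mk0 k0; move: m.+1%:R (m.+1 + k.+1)%:R k.+1%:R => x y z x0 y0 z0.
by field; rewrite x0 y0 z0 expf_neq0.
Unshelve. all: by end_near. Qed.

Lemma cvg_binomial0 (j k : nat) : (j < k)%N ->
  (fun m : nat => 'C(m + j, j)%:R / m%:R ^+ k : R) @ \oo --> (0 : R).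
Proof.
move=> jk; have h : (fun m : nat => ('C(m + j, j)%:R / m%:R ^+ j) * (m%:R^-1 ^+ (k - j)) : R)
    @ \oo --> (j`!%:R^-1 * 0 ^+ (k - j) : R).
  apply: cvgM; first exact: cvg_binomial.
  apply: cvg_exprn; rewrite -cvg_shiftS; exact: cvg_harmonic.
move: h; rewrite expr0n subn_eq0 leqNgt jk mulr0.
suff -> : (fun m : nat => ('C(m + j, j)%:R / m%:R ^+ j) * (m%:R^-1 ^+ (k - j)) : R) =
  (fun m => 'C(m + j, j)%:R / m%:R ^+ k) by [].
by apply/funext => m; rewrite exprVn -mulrA -invfM -exprD subnKC // ltnW.
Qed.

Lemma cvg_lead (k : nat) (c : int) (f : nat -> int) : lead k c f ->
  (fun m : nat => (f m)%:~R / m%:R ^+ k : R) @ \oo --> (c%:~R / k`!%:R : R).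
Proof.
move=> [r hr].
have h n : (n <= k)%N -> (fun m : nat => (\sum_(j < n) r j * 'C(m + j, j)%:Z)%:~R / m%:R ^+ k : R)
    @ \oo --> (0 : R).
  elim: n => [|n IH] nk.
    under eq_fun do rewrite big_ord0 mul0r; exact: cvg_cst.
  under eq_fun do rewrite big_ord_recr /= intrD intrM mulrDl -mulrA.
  have -> : 0 = 0 + (r n)%:~R * 0 :> R by rewrite mulr0 addr0.
  apply: cvgD; first exact: IH (ltnW nk).
  apply: cvgM; [exact: cvg_cst | exact: cvg_binomial0].
under eq_fun do rewrite hr intrD intrM mulrDl -mulrA.
rewrite -[_ / _]addr0; apply: cvgD; last exact: h.
by apply: cvgM; [exact: cvg_cst | exact: cvg_binomial].
Qed.

End LeadingLimit.

(** * Lattice points of the dilations *)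

Section Enumeration.
Local Open Scope ring_scope.
Variable V : finType.

Definition vpair := ({ffun V -> nat} * {ffun V -> nat})%type.
Implicit Types (Y : {set V}) (a : {ffun V -> nat}) (z : vpair).

Definition frestrict Y a : {ffun V -> nat} := [ffun x => if x \in Y then a x else 0%N].
Definition frestrict2 Y z : vpair := (frestrict Y z.1, frestrict Y z.2).
Definition mass a : nat := (\sum_x a x)%N.
Definition addf a a' : {ffun V -> nat} := [ffun x => (a x + a' x)%N].
Definition add2 z z' : vpair := (addf z.1 z'.1, addf z.2 z'.2).

(** Vectors supported in [Y] remain functions on all of [V], so vectors with different supports can
    be added without a change of type. *)
Definition valid Y (C : pred vpair) (A B : nat) : pred vpair := fun z =>
  [&& frestrict2 Y z == z, mass z.1 == A, mass z.2 == B & C z].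

Definition is_local Y (C : pred vpair) : Prop := forall z, C (frestrict2 Y z) = C z.

(** Counting goes through explicit lists because [vpair] is not a finite type. *)
Definition enumerates Y (C : pred vpair) (f : dseries) : Prop :=
  exists s : nat -> nat -> seq vpair, forall A B,
    [/\ uniq (s A B), s A B =i valid Y C A B & (size (s A B))%:Z = f A B].

Lemma in_valid Y C A B z : (z \in valid Y C A B) =
  [&& frestrict2 Y z == z, mass z.1 == A, mass z.2 == B & C z].
Proof. by []. Qed.

Lemma mass_add a a' : mass (addf a a') = (mass a + mass a')%N.
Proof. by rewrite /mass -big_split; apply: eq_bigr => x _; rewrite ffunE. Qed.

Lemma restrict_split Y1 Y2 a : [disjoint Y1 & Y2] ->
  frestrict (Y1 :|: Y2) a = addf (frestrict Y1 a) (frestrict Y2 a).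
Proof.
move=> dY; apply/ffunP => x; rewrite !ffunE finset.in_setU.
case: (boolP (x \in Y1)) => [xY|_] /=; last by [].
by rewrite (disjointFr dY xY) addn0.
Qed.

Lemma restrict_id Y a : frestrict Y (frestrict Y a) = frestrict Y a.
Proof. by apply/ffunP => x; rewrite !ffunE; case: (x \in Y). Qed.

Lemma restrict_addl Y1 Y2 a a' : [disjoint Y1 & Y2] ->
  frestrict Y1 a = a -> frestrict Y2 a' = a' -> frestrict Y1 (addf a a') = a.
Proof.
move=> dY ha ha'; apply/ffunP => x; rewrite -ha -ha' !ffunE.
by case: (boolP (x \in Y1)) => // xY; rewrite (disjointFr dY xY) addn0.
Qed.

Lemma restrict_addr Y1 Y2 a a' : [disjoint Y1 & Y2] ->
  frestrict Y1 a = a -> frestrict Y2 a' = a' -> frestrict Y2 (addf a a') = a'.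
Proof.
move=> dY ha ha'; apply/ffunP => x; rewrite -ha -ha' !ffunE.
by case: (boolP (x \in Y2)) => // xY; rewrite (disjointFl dY xY).
Qed.

Lemma restrict2_add Y1 Y2 z z' : [disjoint Y1 & Y2] ->
  frestrict2 Y1 z = z -> frestrict2 Y2 z' = z' ->
  frestrict2 Y1 (add2 z z') = z /\ frestrict2 Y2 (add2 z z') = z'.
Proof.
case: z => a b; case: z' => a' b' dY [ha hb] [ha' hb'].
by rewrite /frestrict2 /= !(restrict_addl dY) // !(restrict_addr dY).
Qed.

(** A vector supported in the disjoint union is uniquely the sum of its two restrictions, masses
    add, and locality lets each constraint be tested on its own restriction; hence the counts
    convolve. *)
Lemma enumerates_dconv Y1 Y2 (C1 C2 : pred vpair) g f : [disjoint Y1 & Y2] ->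
  is_local Y1 C1 -> is_local Y2 C2 -> enumerates Y1 C1 g -> enumerates Y2 C2 f ->
  enumerates (Y1 :|: Y2) (predI C1 C2) (dconv g f).
Proof.
move=> dY l1 l2 [s1 h1] [s2 h2].
pose t A B (ij : nat * nat) :=
  [seq (z, z') | z <- s1 ij.1 ij.2, z' <- s2 (A - ij.1)%N (B - ij.2)%N].
pose I A B := [seq (i, j) | i <- iota 0 A.+1, j <- iota 0 B.+1].
have inI A B ij : (ij \in I A B) = (ij.1 <= A)%N && (ij.2 <= B)%N.
  apply/allpairsP/andP => [[[i j] [hi hj ->]]|[hi hj]].
    by move: hi hj; rewrite !mem_iota.
  by exists ij; rewrite !mem_iota !add0n !ltnS; case: ij hi hj.
exists (fun A B => [seq add2 zz.1 zz.2 | ij <- I A B, zz <- t A B ij]) => A B.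
have inT ij zz : zz \in t A B ij ->
    valid Y1 C1 ij.1 ij.2 zz.1 /\ valid Y2 C2 (A - ij.1)%N (B - ij.2)%N zz.2.
  move=> /allpairsP[[z z'] /= [zs zs' ->]].
  have [_ e1 _] := h1 ij.1 ij.2; have [_ e2 _] := h2 (A - ij.1)%N (B - ij.2)%N.
  by rewrite e1 in zs; rewrite e2 in zs'.
split.
- apply: allpairs_uniq_dep.
  + by apply: allpairs_uniq; rewrite ?iota_uniq // => -[? ?] [? ?].
  + move=> ij _; apply: allpairs_uniq => [||[? ?] [? ?] //].
      by have [] := h1 ij.1 ij.2.
    by have [] := h2 (A - ij.1)%N (B - ij.2)%N.
  move=> _ _ /allpairsPdep[ij [zz [_ zt ->]]] /allpairsPdep[ij' [zz' [_ zt' ->]]] /= e.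
  have [/and4P[/eqP r1 /eqP i1 /eqP j1 _] /and4P[/eqP r2 _ _ _]] := inT _ _ zt.
  have [/and4P[/eqP r1' /eqP i1' /eqP j1' _] /and4P[/eqP r2' _ _ _]] := inT _ _ zt'.
  have [e1 e2] := restrict2_add dY r1 r2; have [e1' e2'] := restrict2_add dY r1' r2'.
  have ez1 : zz.1 = zz'.1 by rewrite -e1 -e1' e.
  have ez2 : zz.2 = zz'.2 by rewrite -e2 -e2' e.
  have ez : zz = zz' by rewrite [zz]surjective_pairing [zz']surjective_pairing ez1 ez2.
  (* The index of a summand is recovered as the pair of masses of its first component. *)
  have eij : ij = ij'.
    by rewrite [ij]surjective_pairing [ij']surjective_pairing -i1 -j1 -i1' -j1' ez.
  by rewrite eij ez.
- move=> z; apply/allpairsPdep/idP => [[ij [zz [ijI zt ->]]]|].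
    have [/and4P[/eqP r1 /eqP i1 /eqP j1 c1] /and4P[/eqP r2 /eqP i2 /eqP j2 c2]] := inT _ _ zt.
    have [e1 e2] := restrict2_add dY r1 r2.
    move: ijI; rewrite inI => /andP[iA jB].
    apply/and4P; split; last 1 first.
    + by rewrite /= -(l1 (add2 _ _)) -(l2 (add2 _ _)) e1 e2 c1.
    + rewrite /frestrict2 !restrict_split //; move: e1 e2; rewrite /frestrict2.
      by case: zz {zt r1 i1 j1 c1 r2 i2 j2 c2} => [[? ?] [? ?]] /= [-> ->] [-> ->].
    + by rewrite mass_add i1 i2 subnKC.
    + by rewrite mass_add j1 j2 subnKC.
  move=> /and4P[/eqP rz /eqP tA /eqP tB /andP[c1 c2]].
  pose z1 := frestrict2 Y1 z; pose z2 := frestrict2 Y2 z.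
  have ez : z = add2 z1 z2.
    by rewrite -{1}rz /frestrict2 !restrict_split.
  have eA : (mass z1.1 + mass z2.1)%N = A by rewrite -tA [in RHS]ez mass_add.
  have eB : (mass z1.2 + mass z2.2)%N = B by rewrite -tB [in RHS]ez mass_add.
  exists (mass z1.1, mass z1.2); exists (z1, z2); split=> //.
    by rewrite inI -eA -eB !leq_addr.
  apply/allpairsP; exists (z1, z2); split => //=.
    have [_ -> _] := h1 (mass z1.1) (mass z1.2).
    by rewrite in_valid /= !eqxx l1 c1 /frestrict2 /= !restrict_id eqxx.
  have [_ -> _] := h2 (A - mass z1.1)%N (B - mass z1.2)%N.
  by rewrite in_valid /= l2 c2 /frestrict2 /= !restrict_id eqxx -eA -eB !addKn !eqxx.
- have io n : iota 0 n = index_iota 0 n by rewrite /index_iota subn0.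
  rewrite size_allpairs_dep sumnE big_map big_allpairs /dconv !io.
  rewrite (big_morph Posz PoszD (erefl 0)) big_mkord; apply: eq_bigr => i _.
  rewrite (big_morph Posz PoszD (erefl 0)) big_mkord; apply: eq_bigr => j _.
  rewrite size_allpairs PoszM /=.
  by have [_ _ ->] := h1 i j; have [_ _ ->] := h2 (A - i)%N (B - j)%N.
Qed.

Lemma enumerates_nil : enumerates finset.set0 predT delta.
Proof.
pose z0 : vpair := ([ffun=> 0%N], [ffun=> 0%N]).
have t0 : mass [ffun=> 0%N] = 0%N by rewrite /mass big1 // => x _; rewrite ffunE.
have r0 a : frestrict finset.set0 a = [ffun=> 0%N].
  by apply/ffunP => x; rewrite !ffunE finset.in_set0.
exists (fun A B => if (A == 0%N) && (B == 0%N) then [:: z0] else [::]) => A B.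
split; [by case: ifP | | by rewrite /delta; case: ifP].
move=> [a b]; rewrite in_valid /frestrict2 !r0 /= andbT xpair_eqE.
have [<-|na] /= := eqVneq [ffun=> 0%N] a; last first.
  by case: ifP => _; rewrite ?inE // xpair_eqE [a == _]eq_sym (negPf na).
have [<-|nb] /= := eqVneq [ffun=> 0%N] b; last first.
  by case: ifP => _; rewrite ?inE // xpair_eqE [b == _]eq_sym (negPf nb) andbF.
by rewrite t0 ![0%N == _]eq_sym; case: ifP => _; rewrite ?inE ?eqxx.
Qed.

Definition spike (x : V) (n : nat) : {ffun V -> nat} := [ffun y => if y == x then n else 0%N].

Lemma restrict1P (x : V) a : frestrict [set x]%SET a = spike x (a x).
Proof. by apply/ffunP => y; rewrite !ffunE finset.in_set1; case: eqP => // ->. Qed.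

Lemma mass_spike (x : V) (n : nat) : mass (spike x n) = n.
Proof.
rewrite /mass (bigD1 x) //= ffunE eqxx big1 ?addn0 // => y yx.
by rewrite ffunE (negPf yx).
Qed.

Lemma enumerates_single (x : V) : enumerates [set x]%SET predT (fun _ _ => 1).
Proof.
exists (fun A B => [:: (spike x A, spike x B)]) => A B; split => // -[a b].
rewrite inE xpair_eqE in_valid /frestrict2 !restrict1P /= andbT xpair_eqE.
have h c C : (c == spike x C) = (spike x (c x) == c) && (mass c == C).
  apply/eqP/andP => [->|[/eqP <- /eqP <-]]; last by rewrite mass_spike.
  by rewrite mass_spike ffunE !eqxx.
by rewrite !h; case: (spike x (a x) == a); case: (spike x (b x) == b); rewrite //= andbF.
Qed.

Section Triple.
Variables w u v : V.
Hypotheses (wu : w != u) (wv : w != v) (uv : u != v).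
Let Y := [set w; u; v]%SET.

Definition triple (k p q : nat) : {ffun V -> nat} :=
  [ffun x => if x == w then k else if x == u then p else if x == v then q else 0%N].

Lemma restrict_triple a : frestrict Y a = triple (a w) (a u) (a v).
Proof.
apply/ffunP => x; rewrite !ffunE /Y !finset.inE.
have [->|_] //= := eqVneq x w; have [->|_] //= := eqVneq x u.
by have [->|_] := eqVneq x v.
Qed.

Lemma tripleE k p q : (triple k p q w = k) * (triple k p q u = p) * (triple k p q v = q).
Proof.
rewrite !ffunE !eqxx [u == w]eq_sym [v == w]eq_sym [v == u]eq_sym.
by rewrite (negPf wu) (negPf wv) (negPf uv).
Qed.

Lemma mass_triple k p q : mass (triple k p q) = (k + p + q)%N.
Proof.
rewrite /mass (bigD1 w) //= (bigD1 u) 1?eq_sym //= (bigD1 v) /=; last first.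
  by rewrite ![v == _]eq_sym wv uv.
rewrite !tripleE big1 ?addn0 ?addnA // => x /andP[/andP[xw xu] xv].
by rewrite ffunE (negPf xw) (negPf xu) (negPf xv).
Qed.

Definition triples (i c : nat) : seq {ffun V -> nat} :=
  [seq triple k p (i - k - p)%N | k <- iota 0 (minn i c).+1, p <- iota 0 (i - k).+1].

Lemma size_triples i c : size (triples i c) = ntriples i c.
Proof.
have io n : iota 0 n = index_iota 0 n by rewrite /index_iota subn0.
rewrite size_allpairs_dep sumnE big_map io big_mkord.
by apply: eq_bigr => k _; rewrite size_iota.
Qed.

Lemma triples_uniq i c : uniq (triples i c).
Proof.
apply: allpairs_uniq_dep; [exact: iota_uniq | by move=> *; exact: iota_uniq |].
move=> _ _ /allpairsPdep[k [p [_ _ ->]]] /allpairsPdep[k' [p' [_ _ ->]]] /= e.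
have := congr1 (fun a : {ffun V -> nat} => a w) e.
have := congr1 (fun a : {ffun V -> nat} => a u) e.
by rewrite !tripleE => -> ->.
Qed.

Lemma mem_triples i c a : (a \in triples i c) =
  [&& frestrict Y a == a, mass a == i & (a w <= c)%N].
Proof.
rewrite restrict_triple; apply/allpairsPdep/and3P => [[k [p [ki pk ->]]]|].
  move: ki pk; rewrite !mem_iota mass_triple !tripleE eqxx => ki pk.
  by split => //; lia.
move=> [/eqP <-]; rewrite mass_triple !tripleE => /eqP <- wc.
exists (a w), (a u); rewrite !mem_iota; split; [lia|lia|].
by congr triple; lia.
Qed.

Definition triple_constraint (z : vpair) : bool :=
  (z.1 w <= z.2 w + z.2 u + z.2 v)%N && (z.2 w <= z.1 w + z.1 u + z.1 v)%N.

(** With the masses [A] and [B] fixed, the two inequalities decouple into one on the left vector and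
    one on the right, so the list is a full product. *)
Lemma enumerates_triple : enumerates Y triple_constraint gadget.
Proof.
exists (fun A B => [seq (a, b) | a <- triples A B, b <- triples B A]) => A B; split.
- by apply: allpairs_uniq; rewrite ?triples_uniq // => -[? ?] [? ?].
- move=> [a b]; apply/allpairsP/and4P =>
    [[[a' b'] [/= ha hb [-> ->]]]|[/eqP[ra rb] ta tb /andP[cb ca]]].
    move: ha hb; rewrite !mem_triples => /and3P[/eqP ra /eqP ta wa] /and3P[/eqP rb /eqP tb wb].
    rewrite /frestrict2 /= ra rb ta tb !eqxx; split=> //; rewrite /triple_constraint /=.
    by rewrite -!mass_triple -!restrict_triple ra rb ta tb wa.
  exists (a, b); rewrite !mem_triples /= ra rb !eqxx ta tb /=; split=> //.
    by rewrite -(eqP tb) -rb restrict_triple mass_triple.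
  by rewrite -(eqP ta) -ra restrict_triple mass_triple.
- by rewrite size_allpairs !size_triples.
Qed.

End Triple.

Lemma enumerates_singles (xs : seq V) Y C f : uniq xs -> [disjoint [set x in xs]%SET & Y] ->
  is_local Y C -> enumerates Y C f ->
  enumerates ([set x in xs]%SET :|: Y) C (iter (size xs) (fun g => sumx (sumy g)) f).
Proof.
elim: xs => [|x xs IH] /= => [_ _ _|/andP[xxs uxs] dY lY hf].
  have -> : [set x in [::]]%SET = finset.set0 :> {set V}; last by rewrite finset.set0U.
  by apply/setP => x; rewrite !finset.inE.
have eY : [set y in x :: xs]%SET = ([set x] :|: [set y in xs])%SET.
  by apply/setP => y; rewrite !finset.inE.
move: dY; rewrite eY finset.disjoints_subset finset.subUset -!finset.disjoints_subset.
move=> /andP[dx dxs].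
rewrite -finset.setUA.
have dx' : [disjoint [set x]%SET & ([set y in xs] :|: Y)%SET].
  rewrite finset.disjoints1 !finset.inE negb_or xxs; move: dx; by rewrite finset.disjoints1.
have lY' : is_local ([set y in xs] :|: Y)%SET C.
  move=> z; rewrite -lY -[in RHS]lY /frestrict2 /=; congr (C (_, _));
  by apply/ffunP => y; rewrite !ffunE !finset.inE; case: (y \in Y); rewrite ?orbT.
have l1 : is_local [set x]%SET predT by [].
have := enumerates_dconv dx' l1 lY' (enumerates_single x) (IH uxs dxs lY hf).
(* The constant series 1 of a single vertex is XY, so convolution with it is [sumx] after [sumy]. *)
by rewrite -sumxy_delta dconv_sumx dconv_sumy dconv_delta.
Qed.

End Enumeration.

(** * Splitting configurations into edge blocks and unmatched vertices *)

Section TriangleConfigurations.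
Local Open Scope ring_scope.
Variables (N : nat) (MM : {set {set 'I_N}}).
Hypothesis hMM : is_matching (complete_graph N) MM.

Local Notation edge := {e : {set 'I_N} | e \in MM}.
Local Notation vertex := (triangle_vertex MM).

Lemma matching_edge (e : edge) : exists u v, u != v /\ val e = [set u; v]%SET.
Proof.
case/andP: hMM => /fintype.subsetP/(_ _ (valP e))/imsetP[[u v]] uv -> _.
by exists u, v; split.
Qed.

Lemma matching_disjoint (e f : edge) (x : 'I_N) : x \in val e -> x \in val f -> e = f.
Proof.
case/andP: hMM => _ /finset.trivIsetP tr xe xf; apply/eqP/negPn/negP => ef.
have := tr _ _ (valP e) (valP f); rewrite val_eqE => /(_ ef).
by move/disjointFr => /(_ _ xe); rewrite xf.
Qed.

Definition block (e : edge) : {set vertex} :=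
  [set y | match y with inl x => x \in val e | inr f => f == e end]%SET.

Definition covered (es : seq edge) : {set vertex} :=
  [set y | has (fun e => y \in block e) es]%SET.

Definition capacity (e : edge) (z : vpair vertex) : bool :=
  (z.1 (inr e) <= z.2 (inr e) + \sum_(x in val e) z.2 (inl x))%N &&
  (z.2 (inr e) <= z.1 (inr e) + \sum_(x in val e) z.1 (inl x))%N.

Lemma sum_edge (e : edge) (u v : 'I_N) (f : 'I_N -> nat) : u != v -> val e = [set u; v]%SET ->
  (\sum_(x in val e) f x = f u + f v)%N.
Proof.
move=> uv ->; rewrite (bigD1 u) ?finset.set21 //= (bigD1 v) /= ?finset.set22 1?eq_sym //.
rewrite big1 ?addn0 // => x; rewrite finset.in_set2.
by case/andP => /andP[/orP[] /eqP ->]; rewrite eqxx.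
Qed.

Lemma blockE (e : edge) (u v : 'I_N) : val e = [set u; v]%SET ->
  block e = [set (inr e : vertex); inl u; inl v]%SET.
Proof. by move=> ee; apply/setP => -[x|f]; rewrite !finset.inE ?ee ?finset.inE ?orbF. Qed.

Lemma capacityE (e : edge) (u v : 'I_N) : u != v -> val e = [set u; v]%SET ->
  capacity e =1 triple_constraint (inr e : vertex) (inl u) (inl v).
Proof. by move=> uv ee z; rewrite /capacity !(sum_edge _ uv ee) !addnA. Qed.

Lemma enumerates_block (e : edge) : enumerates (block e) (capacity e) gadget.
Proof.
have [u [v [uv ee]]] := matching_edge e; rewrite (blockE ee).
have -> : capacity e = triple_constraint (inr e : vertex) (inl u) (inl v).
  exact/funext/capacityE.
exact: enumerates_triple.
Qed.

Lemma capacity_local (e : edge) (Y : {set vertex}) : block e \subset Y -> is_local Y (capacity e).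
Proof.
move=> /fintype.subsetP eY z; rewrite /capacity /= !ffunE.
have -> : inr e \in Y by apply: eY; rewrite finset.inE.
congr (_ && _); congr (_ <= _ + _)%N; apply: eq_bigr => x xe; rewrite ffunE;
  by rewrite (eY (inl x)) // finset.inE.
Qed.

Lemma capacities_local (es : seq edge) : is_local (covered es) (fun z => all (capacity^~ z) es).
Proof.
move=> z; apply: eq_in_all => e ees; apply: capacity_local.
by apply/fintype.subsetP => y ye; rewrite finset.inE; apply/hasP; exists e.
Qed.

Lemma enumerates_edges (es : seq edge) : uniq es ->
  enumerates (covered es) (fun z => all (capacity^~ z) es) (iter (size es) (dconv gadget) delta).
Proof.
elim: es => [_|e es IH /= /andP[ees ues]].
  have -> : covered [::] = finset.set0 by apply/setP => y; rewrite !finset.inE.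
  exact: enumerates_nil.
have -> : covered (e :: es) = block e :|: covered es.
  by apply/setP => y; rewrite finset.in_setU [LHS]finset.in_set [y \in covered es]finset.in_set.
apply: enumerates_dconv (enumerates_block e) (IH ues).
- apply/pred0P => y /=; apply/negbTE/negP => /andP[ye]; rewrite finset.inE => /hasP[f fes yf].
  suff ef : e = f by rewrite ef fes in ees.
  move: ye yf; rewrite !finset.inE; case: y => [x|g]; first exact: matching_disjoint.
  by move=> /eqP <- /eqP.
- exact: capacity_local.
- exact: capacities_local.
Qed.

Lemma iter_sumxy p f : iter p (fun g => sumx (sumy g)) f = iter p sumx (iter p sumy f).
Proof.
have h n g : sumy (iter n sumx g) = iter n sumx (sumy g).
  by elim: n => //= n IH; rewrite -sumxy IH.
by elim: p => //= p ->; rewrite h.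
Qed.

Lemma card_matched : #|finset.cover MM| = (2 * #|MM|)%N.
Proof.
case/andP: hMM => _ /eqP <-; rewrite mulnC -sum_nat_const; apply: eq_bigr => A AM.
by have [u [v [uv /= ->]]] := matching_edge (Sub A AM); rewrite cards2 uv.
Qed.

Lemma matched_le : (2 * #|MM| <= N)%N.
Proof. by rewrite -card_matched -[X in (_ <= X)%N]card_ord max_card. Qed.

Definition admissible (z : vpair vertex) : bool := [forall e, capacity e z].

(** The vertex set is the disjoint union of one block per matching edge and of the unmatched
    vertices, N - 2 M in number. *)
Lemma enumerates_triangle (p := (N - 2 * #|MM|)%N) :
  enumerates [set: vertex]%SET admissible (nconfig p p #|MM|).
Proof.
pose xs : seq vertex := [seq inl x | x <- enum (~: finset.cover MM)%SET].
have sxs : size xs = p.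
  by rewrite size_map -cardE cardsCs finset.setCK card_matched card_ord.
have ues : uniq (enum [set: edge]%SET) by exact: enum_uniq.
have he := enumerates_edges ues.
have dxs : [disjoint [set y in xs]%SET & covered (enum [set: edge]%SET)].
  apply/pred0P => y /=; apply/negbTE/negP; rewrite !finset.inE.
  case/andP => /mapP[x]; rewrite mem_enum finset.in_setC => /negP xM -> /hasP[e _].
  by rewrite finset.inE => xe; apply: xM; apply/finset.bigcupP; exists (val e) => //; exact: valP.
have uxs : uniq xs by rewrite map_inj_uniq ?enum_uniq // => ? ? [].
have := enumerates_singles uxs dxs (@capacities_local _) he.
rewrite sxs iter_sumxy -cardE cardsT card_sig.
have -> : #|[pred e in MM]| = #|MM| by [].
have -> : (fun z => all (capacity^~ z) (enum [set: edge]%SET)) = admissible.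
  apply/funext => z; apply/allP/forallP => h e; last by [].
  by apply: h; rewrite mem_enum finset.in_setT.
suff -> : ([set y in xs] :|: covered (enum [set: edge]))%SET = [set: vertex]%SET by [].
apply/setP => -[x|e]; rewrite !finset.inE; last first.
  by apply/orP; right; apply/hasP; exists e; rewrite ?mem_enum ?finset.in_setT // finset.inE.
rewrite mem_map; last by move=> ? ? [].
rewrite mem_enum finset.in_setC; case: (boolP (x \in _)) => //= /finset.bigcupP[A AM xA].
by apply/hasP; exists (Sub A AM); rewrite ?mem_enum ?finset.in_setT // finset.inE.
Qed.

End TriangleConfigurations.

(** * Dimension and lattice charts *)

Section HeightMatrix.
Local Open Scope ring_scope.

Definition height_mx (T : pzRingType) (n : nat) : 'M[T]_(n + n, 1 + 1) :=
  block_mx (const_mx 1) 0 0 (const_mx 1).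

Lemma intmx_height (R : realType) (n : nat) : intmx R (height_mx int n) = height_mx R n.
Proof. by rewrite /intmx map_block_mx !map_mx0 !map_const_mx. Qed.

Lemma mulmx_const1 (T : pzRingType) (n : nat) (x : 'rV[T]_n) :
  x *m const_mx 1 = const_mx (\sum_i x 0 i) :> 'M[T]_1.
Proof. by apply/rowP => j; rewrite !mxE; apply: eq_bigr => i _; rewrite mxE mulr1. Qed.

Lemma heightP (T : pzRingType) (n : nat) (x : 'rV[T]_(n + n)) (a : T) :
  x *m height_mx T n = const_mx a <->
  \sum_i x 0 (lshift n i) = a /\ \sum_i x 0 (rshift n i) = a.
Proof.
rewrite -{1}(hsubmxK x) /height_mx mul_row_block !mulmx0 addr0 add0r !mulmx_const1.
rewrite -row_mx_const.
have el : \sum_i lsubmx x 0 i = \sum_i x 0 (lshift n i) by apply: eq_bigr => i _; rewrite mxE.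
have er : \sum_i rsubmx x 0 i = \sum_i x 0 (rshift n i) by apply: eq_bigr => i _; rewrite mxE.
rewrite el er; split=> [/eq_row_mx[/matrixP/(_ 0 0) + /matrixP/(_ 0 0)]|[-> ->] //].
by rewrite !mxE.
Qed.

(** The rows e_i - e_0 form a lattice basis of the directions of the standard simplex. *)
Definition simplex_dir (T : pzRingType) (m : nat) : 'M[T]_(m, 1 + m) :=
  row_mx (const_mx (-1)) 1%:M.

Lemma simplex_dir_free (T : pzRingType) (m : nat) :
  simplex_dir T m *m col_mx 0 1%:M = 1%:M.
Proof. by rewrite mul_row_col mulmx0 add0r mulmx1. Qed.

Lemma simplex_dir_const (T : pzRingType) (m : nat) :
  simplex_dir T m *m const_mx 1 = 0 :> 'M[T]_(m, 1).
Proof.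
apply/matrixP => i j; rewrite mxE big_split_ord /= big_ord1 row_mxEl !mxE mulr1.
rewrite (bigD1 i) //= row_mxEr !mxE eqxx mulr1 big1 ?addr0 ?addNr // => k ki.
by rewrite row_mxEr !mxE eq_sym (negPf ki) mul0r.
Qed.

Lemma simplex_dirP (T : pzRingType) (m : nat) (l : 'rV[T]_(1 + m)) : \sum_i l 0 i = 1 ->
  l = delta_mx 0 (lshift m 0) + rsubmx l *m simplex_dir T m.
Proof.
move=> l1; apply/rowP => j; rewrite /simplex_dir mul_mx_row [RHS]mxE mulmx1.
case: (split_ordP j) => k ->.
  have -> : l 0 (lshift m k) = 1 - \sum_i l 0 (rshift 1 i).
    by rewrite -l1 big_split_ord /= big_ord1 addrK ord1.
  rewrite row_mxEl ord1 !mxE !eqxx; congr (_ + _).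
  by rewrite -sumrN; apply: eq_bigr => i _; rewrite !mxE mulrN1.
by rewrite row_mxEr !mxE eq_rlshift andbF add0r.
Qed.

Definition height_origin (T : pzRingType) (m : nat) : 'rV[T]_((1 + m) + (1 + m)) :=
  row_mx (delta_mx 0 (lshift m 0)) (delta_mx 0 (lshift m 0)).
Definition height_dir (T : pzRingType) (m : nat) : 'M[T]_(m + m, (1 + m) + (1 + m)) :=
  block_mx (simplex_dir T m) 0 0 (simplex_dir T m).

Lemma height_origin_sum (T : pzRingType) (m : nat) :
  height_origin T m *m height_mx T (1 + m) = const_mx 1.
Proof.
have d : \sum_i (delta_mx 0 (lshift m 0) : 'rV[T]_(1 + m)) 0 i = 1.
  rewrite (bigD1 (lshift m 0)) //= mxE !eqxx big1 ?addr0 // => i i0.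
  by rewrite mxE (negPf i0) andbF.
apply/heightP; split; rewrite -[RHS]d; apply: eq_bigr => i _.
  by rewrite row_mxEl.
by rewrite row_mxEr.
Qed.

Lemma height_dir_sum (T : pzRingType) (m : nat) :
  height_dir T m *m height_mx T (1 + m) = 0.
Proof.
rewrite mulmx_block !mulmx0 !mul0mx !addr0 !add0r simplex_dir_const.
by rewrite block_mx_const.
Qed.

(** Valid over any ring: over [R] it parametrizes the affine hull, over [int] its integer points,
    and together these make a lattice chart. *)
Lemma height_chartP (T : pzRingType) (m : nat) (x : 'rV[T]_((1 + m) + (1 + m))) :
  x *m height_mx T (1 + m) = const_mx 1 <->
  exists c, x = height_origin T m + c *m height_dir T m.
Proof.
split=> [/heightP[lx rx]|[c ->]]; last first.
  by rewrite mulmxDl -mulmxA height_dir_sum mulmx0 addr0 height_origin_sum.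
exists (row_mx (rsubmx (lsubmx x)) (rsubmx (rsubmx x))).
rewrite mul_row_block !mulmx0 addr0 add0r add_row_mx -!simplex_dirP ?hsubmxK //.
  by rewrite -[RHS]rx; apply: eq_bigr => i _; rewrite mxE.
by rewrite -[RHS]lx; apply: eq_bigr => i _; rewrite mxE.
Qed.

Lemma intmx_height_dir (R : realType) (m : nat) :
  intmx R (height_dir int m) = height_dir R m.
Proof.
rewrite /intmx map_block_mx !map_mx0 /simplex_dir map_row_mx map_const_mx map_mx1.
by rewrite rmorphN1.
Qed.

Lemma intmx_height_origin (R : realType) (m : nat) :
  intmx R (height_origin int m) = height_origin R m.
Proof. by rewrite /intmx map_row_mx !map_delta_mx. Qed.

Lemma height_dir_free (F : fieldType) (m : nat) : row_free (height_dir F m).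
Proof.
apply/row_freeP; exists (block_mx (col_mx 0 1%:M) 0 0 (col_mx 0 1%:M)).
by rewrite mulmx_block !mulmx0 !mul0mx !addr0 !add0r !simplex_dir_free -scalar_mx_block.
Qed.

End HeightMatrix.

(** * Dimension and normalized volume of a polytope spanning the height plane *)

Section NormalizedVolume.
Local Open Scope classical_set_scope.
Local Open Scope ring_scope.
Variable R : realType.

(** Differences of points of the first flat place the rows of [B] in the row space of [C]. *)
Lemma affine_dim_le (d k l : nat) (p q : 'rV[R]_d) (B : 'M[R]_(k, d)) (C : 'M[R]_(l, d)) :
  row_free B ->
  [set p + c *m B | c in [set: 'rV[R]_k]] `<=` [set q + c *m C | c in [set: 'rV[R]_l]] ->
  (k <= l)%N.
Proof.
move=> /eqP rB BC; rewrite -{1}rB.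
have [c0 _ e0] : [set q + c *m C | c in [set: 'rV[R]_l]] p.
  by apply: BC; exists 0 => //; rewrite mul0mx addr0.
apply: leq_trans (rank_leq_row C); apply: mxrankS; apply/row_subP => i.
have [c1 _ e1] : [set q + c *m C | c in [set: 'rV[R]_l]] (p + row i B).
  by apply: BC; exists (delta_mx 0 i) => //; rewrite -rowE.
have -> : row i B = (c1 - c0) *m C.
  by apply: (addrI p); rewrite -e1 -e0 mulmxBl -addrA [c0 *m C + _]addrC subrK.
exact: submxMl.
Qed.

Variables (m : nat) (P : set 'rV[R]_((1 + m) + (1 + m))).
Hypothesis affP : affine_hull P = [set x | x *m height_mx R (1 + m) = const_mx 1].

Lemma affine_hull_chart :
  affine_hull P = [set height_origin R m + c *m height_dir R m | c in [set: 'rV[R]_(m + m)]].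
Proof.
rewrite affP; apply/seteqP; split=> x /=.
  by move=> /height_chartP[c ->]; exists c.
by move=> [c _ <-]; apply/height_chartP; exists c.
Qed.

Lemma pdim_height : pdim P = (m + m)%N.
Proof.
have km : (m + m < ((1 + m) + (1 + m)).+1)%N by lia.
rewrite /pdim (big_pred1 (Ordinal km)) // => k; apply/asboolP/eqP => [[p [B [fB hB]]]|->].
  apply/val_inj/eqP; rewrite /= eqn_leq; apply/andP; split.
    apply: (affine_dim_le (p := p) (q := height_origin R m) (C := height_dir R m) fB).
    by rewrite -hB affine_hull_chart.
  apply: (affine_dim_le (p := height_origin R m) (q := p) (C := B) (height_dir_free R m)).
  by rewrite -hB affine_hull_chart.
exists (height_origin R m), (height_dir R m).
by split; [exact: height_dir_free | exact: affine_hull_chart].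
Qed.

Lemma height_lattice_chart : lattice_chart P (height_origin int m) (height_dir int m).
Proof.
split.
- by rewrite intmx_height_dir height_dir_free.
- by rewrite intmx_height_dir intmx_height_origin affine_hull_chart.
- move=> z; rewrite affP /= -intmx_height -intmxM => e; apply/height_chartP.
  by apply: (@intmx_inj R); rewrite e intmx_const.
Qed.

(** Since [relvol] selects a value with [get], the volume is required in every chart, and the
    standard chart shows that there is a value to select. *)
Lemma NVol_height (v : R) :
  (forall p (B : 'M[int]_(m + m, (1 + m) + (1 + m))), lattice_chart P p B ->
     lebesgue_rV [set c : 'rV[R]_(m + m) | P (intmx R p + c *m intmx R B)] =
     (v / (m + m)`!%:R)%:E) ->
  NVol P = v%:E.
Proof.
rewrite /NVol /relvol pdim_height => h.
set S := [set _ | _]; have [p [B [ch ->]]] : S (get S).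
  apply: getPex; eexists; exists (height_origin int m), (height_dir int m).
  by split; [exact: height_lattice_chart | reflexivity].
by rewrite h // -EFinM mulrC divfK // pnatr_eq0 -lt0n fact_gt0.
Qed.

End NormalizedVolume.

Section NormalizedVolumePos.
Local Open Scope classical_set_scope.
Local Open Scope ring_scope.

(** Makes the result applicable to a cardinal, which is not syntactically of the form 1 + m. *)
Lemma NVol_height_pos (R : realType) (n : nat) (P : set 'rV[R]_(n + n)) (v : R) : (0 < n)%N ->
  affine_hull P = [set x | x *m height_mx R n = const_mx 1] ->
  (forall p (B : 'M[int]_(n.-1 + n.-1, n + n)), lattice_chart P p B ->
     lebesgue_rV [set c : 'rV[R]_(n.-1 + n.-1) | P (intmx R p + c *m intmx R B)] =
     (v / (n.-1 + n.-1)`!%:R)%:E) ->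
  NVol P = v%:E.
Proof. by case: n P => // m P _ aff h; exact: (NVol_height (P := P) aff h). Qed.

End NormalizedVolumePos.

(** * Edge polytopes of bipartite graphs *)

Section Coordinates.
Local Open Scope ring_scope.
Variables (T : pzRingType) (V : finType).
Implicit Types (x : 'rV[T]_(#|V| + #|V|)) (v : V).

Definition lcoord x v : T := x 0 (lshift #|V| (enum_rank v)).
Definition rcoord x v : T := x 0 (rshift #|V| (enum_rank v)).

Lemma coordP x y : lcoord x =1 lcoord y -> rcoord x =1 rcoord y -> x = y.
Proof.
move=> el er; apply/rowP => j; case: (split_ordP j) => i ->.
  by have := el (enum_val i); rewrite /lcoord enum_valK.
by have := er (enum_val i); rewrite /rcoord enum_valK.
Qed.

Lemma sum_enum_rank (f : 'I_#|V| -> T) : \sum_i f i = \sum_v f (enum_rank v).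
Proof. by rewrite (reindex enum_rank) //; apply: onW_bij; exact: enum_rank_bij. Qed.

Lemma coord_heightP x (a : T) : x *m height_mx T #|V| = const_mx a <->
  \sum_v lcoord x v = a /\ \sum_v rcoord x v = a.
Proof. by rewrite heightP !sum_enum_rank. Qed.

Lemma lcoord_sum I (r : seq I) (F : I -> 'rV[T]_(#|V| + #|V|)) v :
  lcoord (\sum_(i <- r) F i) v = \sum_(i <- r) lcoord (F i) v.
Proof. by rewrite /lcoord summxE. Qed.
Lemma rcoord_sum I (r : seq I) (F : I -> 'rV[T]_(#|V| + #|V|)) v :
  rcoord (\sum_(i <- r) F i) v = \sum_(i <- r) rcoord (F i) v.
Proof. by rewrite /rcoord summxE. Qed.

Lemma lcoordZ (a : T) x v : lcoord (a *: x) v = a * lcoord x v.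
Proof. by rewrite /lcoord mxE. Qed.
Lemma rcoordZ (a : T) x v : rcoord (a *: x) v = a * rcoord x v.
Proof. by rewrite /rcoord mxE. Qed.

Lemma lcoordD x y v : lcoord (x + y) v = lcoord x v + lcoord y v.
Proof. by rewrite /lcoord mxE. Qed.
Lemma rcoordD x y v : rcoord (x + y) v = rcoord x v + rcoord y v.
Proof. by rewrite /rcoord mxE. Qed.
Lemma lcoordB x y v : lcoord (x - y) v = lcoord x v - lcoord y v.
Proof. by rewrite /lcoord !mxE. Qed.
Lemma rcoordB x y v : rcoord (x - y) v = rcoord x v - rcoord y v.
Proof. by rewrite /rcoord !mxE. Qed.

Lemma sum_indicator (f : V -> T) v : \sum_i f i * (v == i)%:R = f v.
Proof.
rewrite (bigD1 v) //= eqxx mulr1 big1 ?addr0 // => i iv.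
by rewrite eq_sym (negPf iv) mulr0.
Qed.

End Coordinates.

Section Hulls.
Local Open Scope classical_set_scope.
Local Open Scope ring_scope.
Variable R : realType.

Lemma lcoord_PQ (V : finType) (i j v : V) : lcoord (PQ_point R i j) v = (v == i)%:R.
Proof. by rewrite /lcoord row_mxEl mxE eqxx (inj_eq enum_rank_inj). Qed.
Lemma rcoord_PQ (V : finType) (i j v : V) : rcoord (PQ_point R i j) v = (v == j)%:R.
Proof. by rewrite /rcoord row_mxEr mxE eqxx (inj_eq enum_rank_inj). Qed.

Lemma PQ_pointBl (V : finType) (i j k l : V) :
  PQ_point R i k - PQ_point R j k = PQ_point R i l - PQ_point R j l.
Proof. by rewrite /PQ_point !opp_row_mx !add_row_mx !subrr. Qed.
Lemma PQ_pointBr (V : finType) (i j k l : V) :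
  PQ_point R k i - PQ_point R k j = PQ_point R l i - PQ_point R l j.
Proof. by rewrite /PQ_point !opp_row_mx !add_row_mx !subrr. Qed.

Lemma convex_hull_point (d : nat) (A : set 'rV[R]_d) x : A x -> convex_hull A x.
Proof.
move=> Ax; exists 1%N, (fun=> x), (fun=> 1); split=> //; first by rewrite big_ord1.
by rewrite big_ord1 scale1r.
Qed.

Lemma affine_hull_point (d : nat) (A : set 'rV[R]_d) x : A x -> affine_hull A x.
Proof.
move=> Ax; exists 1%N, (fun=> x), (fun=> 1); split=> //; first by rewrite big_ord1.
by rewrite big_ord1 scale1r.
Qed.

Lemma affine_hull_shift (d : nat) (A : set 'rV[R]_d) x p q t :
  A p -> A q -> affine_hull A x -> affine_hull A (x + t *: (p - q)).
Proof.
move=> Ap Aq [m [g [w [gA w1 ->]]]].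
(* The points [p] and [q] join with weights t and -t, which keeps the total weight equal to 1. *)
exists (m + 2)%N,
  (fun i => match fintype.split i with inl k => g k | inr k => if k == 0 then p else q end),
  (fun i => match fintype.split i with inl k => w k | inr k => if k == 0 then t else - t end).
split.
- by move=> i; case: fintype.split => k //; case: ifP.
- rewrite big_split_ord /= -[RHS]addr0 -{1}w1; congr (_ + _).
    by apply: eq_bigr => i _; rewrite (unsplitK (inl i)).
  rewrite big_ord_recl big_ord1 !(unsplitK (inr _)) /=; exact: subrr.
- rewrite [RHS]big_split_ord /=; congr (_ + _).
    by apply: eq_bigr => i _; rewrite (unsplitK (inl i)).
  rewrite big_ord_recl big_ord1 !(unsplitK (inr _)) /=.
  by rewrite scalerBr scaleNr.
Qed.

(** The linear space parallel to the affine hull, described by translations so that directions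
    compose without a base point. *)
Definition direction (d : nat) (A : set 'rV[R]_d) (w : 'rV[R]_d) : Prop :=
  forall t x, affine_hull A x -> affine_hull A (x + t *: w).

Lemma directionD (d : nat) (A : set 'rV[R]_d) w w' :
  direction A w -> direction A w' -> direction A (w + w').
Proof. by move=> h h' t x hx; rewrite scalerDr addrA; apply/h'/h. Qed.

Lemma affine_hull_directions (d : nat) (A : set 'rV[R]_d) (I : eqType) (r : seq I)
    (c : I -> R) (w : I -> 'rV[R]_d) x :
  (forall i, direction A (w i)) -> affine_hull A x ->
  affine_hull A (x + \sum_(i <- r) c i *: w i).
Proof.
move=> hw; elim: r x => [|i r IH] x hx; first by rewrite big_nil addr0.
by rewrite big_cons addrA; apply/IH/hw.
Qed.

Section Flow.
Variables (V : finType) (G : sgraph V).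

(** A flow on the bipartite graph with marginals (a, b) is itself a system of convex weights on the
    generating points. *)
Lemma PQ_flow (phi : V -> V -> R) (x : 'rV[R]_(#|V| + #|V|)) :
  (forall i j, 0 <= phi i j) -> (forall i j, phi i j != 0 -> i = j \/ adj G i j) ->
  (forall i, lcoord x i = \sum_j phi i j) -> (forall j, rcoord x j = \sum_i phi i j) ->
  \sum_i lcoord x i = 1 -> PQ_polytope R G x.
Proof.
move=> phi0 phiG hl hr x1.
pose k := #|{: V * V}|; pose e (i : 'I_k) : V * V := enum_val i.
have se (U : nmodType) (F : V * V -> U) : \sum_(i < k) F (e i) = \sum_i \sum_j F (i, j).
  rewrite pair_bigA [RHS](reindex e) /=; last exact/onW_bij/enum_val_bij.
  by apply: eq_bigr => i _; rewrite -surjective_pairing.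
(* A pair carrying no flow may fail to be an edge; a diagonal point replaces it, with weight 0. *)
exists k, (fun i => if phi (e i).1 (e i).2 == 0 then PQ_point R (e i).1 (e i).1
                    else PQ_point R (e i).1 (e i).2),
  (fun i => phi (e i).1 (e i).2).
split => [i|i||].
- case: (eqVneq (phi (e i).1 (e i).2) 0) => [_|/phiG h]; last by exists (e i).1, (e i).2.
  by exists (e i).1, (e i).1; split=> //; left.
- exact: phi0.
- by rewrite (se _ (fun p => phi p.1 p.2)) /= -[RHS]x1; apply: eq_bigr => i _.
have -> : \sum_(i < k) phi (e i).1 (e i).2 *:
    (if phi (e i).1 (e i).2 == 0 then PQ_point R (e i).1 (e i).1 else PQ_point R (e i).1 (e i).2)
  = \sum_i \sum_j phi i j *: PQ_point R i j.
  rewrite -(se _ (fun p => phi p.1 p.2 *: PQ_point R p.1 p.2)); apply: eq_bigr => i _.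
  by case: eqVneq => // ->; rewrite !scale0r.
apply: coordP => v.
  rewrite hl lcoord_sum [RHS](bigD1 v) //= [X in _ + X]big1 ?addr0 => [|i iv].
    by rewrite lcoord_sum; apply: eq_bigr => j _; rewrite lcoordZ lcoord_PQ eqxx mulr1.
  by rewrite lcoord_sum big1 // => j _; rewrite lcoordZ lcoord_PQ eq_sym (negPf iv) mulr0.
rewrite hr rcoord_sum; apply: eq_bigr => i _; rewrite rcoord_sum (bigD1 v) //= big1 ?addr0.
  by rewrite rcoordZ rcoord_PQ eqxx mulr1.
by move=> j jv; rewrite rcoordZ rcoord_PQ eq_sym (negPf jv) mulr0.
Qed.

Lemma PQ_pointP (i j : V) : i = j \/ adj G i j -> PQ_polytope R G (PQ_point R i j).
Proof. by move=> ij; apply: convex_hull_point; exists i, j. Qed.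

Lemma PQ_ind (c : 'cV[R]_(#|V| + #|V|)) x :
  (forall i j, i = j \/ adj G i j -> 0 <= (PQ_point R i j *m c) 0 0) ->
  PQ_polytope R G x -> 0 <= (x *m c) 0 0.
Proof.
move=> h [m [p [w [pA w0 w1 ->]]]]; rewrite mulmx_suml summxE; apply: sumr_ge0 => i _.
rewrite -scalemxAl mxE; apply: mulr_ge0 => //.
by have [u [v [uv ->]]] := pA i; exact: h.
Qed.

Lemma affine_combination_height (S : set 'rV[R]_(#|V| + #|V|)) m
    (p : 'I_m -> 'rV[R]_(#|V| + #|V|)) (w : 'I_m -> R) :
  (forall x, S x -> x *m height_mx R #|V| = const_mx 1) ->
  (forall i, S (p i)) -> \sum_i w i = 1 ->
  (\sum_i w i *: p i) *m height_mx R #|V| = const_mx 1.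
Proof.
move=> h pS w1; rewrite mulmx_suml.
under eq_bigr do rewrite -scalemxAl h //.
by rewrite -scaler_suml w1 scale1r.
Qed.

Lemma PQ_height x : PQ_polytope R G x -> x *m height_mx R #|V| = const_mx 1.
Proof.
move=> [m [p [w [pA _ w1 ->]]]]; apply: affine_combination_height pA w1.
move=> _ [i [j [_ ->]]]; apply/coord_heightP; split.
  by rewrite (bigD1 i) //= lcoord_PQ eqxx big1 ?addr0 // => v vi; rewrite lcoord_PQ (negPf vi).
by rewrite (bigD1 j) //= rcoord_PQ eqxx big1 ?addr0 // => v vi; rewrite rcoord_PQ (negPf vi).
Qed.

(* The hypothesis holds when the bipartite graph of [PQ_polytope] is connected. *)
Lemma affine_hull_PQ (r : V) :
  (forall v, direction (PQ_polytope R G) (PQ_point R v r - PQ_point R r r)) ->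
  (forall v, direction (PQ_polytope R G) (PQ_point R r v - PQ_point R r r)) ->
  affine_hull (PQ_polytope R G) = [set x | x *m height_mx R #|V| = const_mx 1].
Proof.
move=> dl dr; apply/seteqP; split=> [_ [m [p [w [pP w1 ->]]]]|x /coord_heightP[xl xr]] /=.
  exact: affine_combination_height PQ_height pP w1.
(* As each half of x sums to 1, the contributions at r of each sum cancel the base point up to the
   coordinate of x. *)
have -> : x = PQ_point R r r
    + \sum_v lcoord x v *: (PQ_point R v r - PQ_point R r r)
    + \sum_v rcoord x v *: (PQ_point R r v - PQ_point R r r).
  apply: coordP => v; [rewrite !lcoordD !lcoord_sum | rewrite !rcoordD !rcoord_sum].
    under eq_bigr do rewrite lcoordZ lcoordB !lcoord_PQ mulrBr.
    under [X in _ = _ + X]eq_bigr do rewrite lcoordZ lcoordB !lcoord_PQ subrr mulr0.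
    by rewrite sumrB sum_indicator -mulr_suml xl mul1r big1_eq addr0 lcoord_PQ addrC subrK.
  under eq_bigr do rewrite rcoordZ rcoordB !rcoord_PQ subrr mulr0.
  under [X in _ = _ + X]eq_bigr do rewrite rcoordZ rcoordB !rcoord_PQ mulrBr.
  by rewrite sumrB sum_indicator -mulr_suml xr mul1r big1_eq addr0 rcoord_PQ addrC subrK.
apply: affine_hull_directions dr _; apply: affine_hull_directions dl _.
by apply/affine_hull_point/PQ_pointP; left.
Qed.

End Flow.
End Hulls.

(** * The polytope of a complete graph with triangles on a matching *)

Section TrianglePolytope.
Local Open Scope classical_set_scope.
Local Open Scope ring_scope.
Variables (R : realType) (N : nat) (MM : {set {set 'I_N}}).
Hypothesis hMM : is_matching (complete_graph N) MM.

Local Notation edge := {e : {set 'I_N} | e \in MM}.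
Local Notation vertex := (triangle_vertex MM).
Local Notation graph := (triangle_graph (complete_graph N) MM).

Lemma sum_vertex (U : nmodType) (f : vertex -> U) :
  \sum_v f v = \sum_i f (inl i) + \sum_e f (inr e).
Proof. exact: big_sumType. Qed.

Section Residual.
Variables (a : 'I_N -> R) (d : edge -> R).
Hypotheses (a0 : forall x, 0 <= a x) (d0 : forall e, 0 <= d e).
Hypothesis da : forall e, d e <= \sum_(x in val e) a x.

(* Division by zero gives 0, which is the right share when the edge has no mass. *)
Definition share (e : edge) (x : 'I_N) : R := d e * a x / \sum_(y in val e) a y.

Definition residual (x : 'I_N) : R := a x - \sum_(e : edge | x \in val e) share e x.

Lemma edge_mass_ge0 (e : edge) : 0 <= \sum_(y in val e) a y.
Proof. by apply: sumr_ge0. Qed.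

Lemma share_ge0 (e : edge) (x : 'I_N) : 0 <= share e x.
Proof. by rewrite divr_ge0 ?mulr_ge0 ?edge_mass_ge0. Qed.

Lemma share_le (e : edge) (x : 'I_N) : share e x <= a x.
Proof.
have [s0|sp] := leP (\sum_(y in val e) a y) 0; last first.
  by rewrite ler_pdivrMr // mulrC ler_wpM2l.
have : \sum_(y in val e) a y = 0 by apply/eqP; rewrite eq_le s0 edge_mass_ge0.
by rewrite /share => ->; rewrite invr0 mulr0.
Qed.

Lemma sum_share (e : edge) : \sum_(x in val e) share e x = d e.
Proof.
rewrite -mulr_suml -mulr_sumr; have [s0|sn0] := eqVneq (\sum_(y in val e) a y) 0.
  by rewrite s0 mulr0 mul0r; apply/le_anti; rewrite d0 -s0 da.
by rewrite mulfK.
Qed.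

(** In a matching at most one edge draws on x, and its share does not exceed [a x]. *)
Lemma residual_ge0 (x : 'I_N) : 0 <= residual x.
Proof.
rewrite subr_ge0; case: (pickP (fun e : edge => x \in val e)) => [e xe|no]; last first.
  by rewrite big_pred0 // a0.
rewrite (bigD1 e) //= big1 ?addr0 ?share_le // => f /andP[xf].
by rewrite (matching_disjoint hMM xf xe) eqxx.
Qed.

Lemma sum_residual : \sum_x residual x = \sum_x a x - \sum_e d e.
Proof.
rewrite sumrB; congr (_ - _); rewrite (exchange_big_dep predT) //=.
by apply: eq_bigr => e _; rewrite -[RHS]sum_share.
Qed.

End Residual.

(** Each new vertex first sends the smaller of its two masses to itself. The excess on the other
    side is exchanged with the endpoints of its edge in proportional shares, within capacity. The
    residual masses of the original vertices have the same total S on both sides, and since all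
    pairs are allowed in K_N with loops, the product flow divided by S carries them. *)
Lemma triangle_flow (a b : vertex -> R) :
  (forall v, 0 <= a v) -> (forall v, 0 <= b v) -> \sum_v a v = \sum_v b v ->
  (forall e : edge, a (inr e) <= b (inr e) + \sum_(x in val e) b (inl x)) ->
  (forall e : edge, b (inr e) <= a (inr e) + \sum_(x in val e) a (inl x)) ->
  exists phi : vertex -> vertex -> R,
    [/\ forall i j, 0 <= phi i j, forall i j, phi i j != 0 -> i = j \/ adj graph i j,
        forall i, a i = \sum_j phi i j & forall j, b j = \sum_i phi i j].
Proof.
move=> a0 b0 ab capa capb.
pose t (e : edge) := Num.min (a (inr e)) (b (inr e)).
pose da (e : edge) := b (inr e) - t e; pose db (e : edge) := a (inr e) - t e.
pose al i := a (inl i); pose bl i := b (inl i).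
have t0 e : 0 <= t e by rewrite le_min a0 b0.
have da0 e : 0 <= da e by rewrite subr_ge0 ge_min lexx orbT.
have db0 e : 0 <= db e by rewrite subr_ge0 ge_min lexx.
have al0 i : 0 <= al i by exact: a0.
have bl0 i : 0 <= bl i by exact: b0.
have daa e : da e <= \sum_(x in val e) al x.
  rewrite /da /t; case: (leP (a (inr e)) (b (inr e))) => _; first by rewrite lerBlDl capb.
  by rewrite subrr edge_mass_ge0.
have dbb e : db e <= \sum_(x in val e) bl x.
  rewrite /db /t; case: (leP (a (inr e)) (b (inr e))) => _; last by rewrite lerBlDl capa.
  by rewrite subrr edge_mass_ge0.
pose S := \sum_x residual al da x.
have Sb : S = \sum_x residual bl db x.
  rewrite /S !sum_residual //; move: ab; rewrite !sum_vertex => ab.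
  have : \sum_e da e - \sum_e db e = \sum_e b (inr e) - \sum_e a (inr e).
    by rewrite -!sumrB; apply: eq_bigr => e _; rewrite /da /db; lra.
  by rewrite /al /bl; lra.
have ra0 := residual_ge0 al0 daa; have rb0 := residual_ge0 bl0 dbb.
have S0 : 0 <= S by apply: sumr_ge0.
(* If S = 0 all residuals vanish, so the value 0 of the division is correct. *)
have full (r : 'I_N -> R) x : (forall y, 0 <= r y) -> \sum_y r y = S -> r x * S / S = r x.
  move=> r0 rS; have [s0|sn0] := eqVneq S 0; last by rewrite mulfK.
  have rx : r x <= S by rewrite -rS (bigD1 x) //= lerDl sumr_ge0.
  by rewrite s0 mulr0 mul0r; apply/le_anti; rewrite r0 -s0 rx.
exists (fun i j : vertex => match i, j with
  | inl x, inl y => residual al da x * residual bl db y / S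
  | inl x, inr e => if x \in val e then share al da e x else 0
  | inr e, inl y => if y \in val e then share bl db e y else 0
  | inr e, inr f => if e == f then t e else 0 end).
split.
- move=> [x|e] [y|f].
  + by rewrite divr_ge0 ?mulr_ge0.
  + by case: ifP => // _; exact: share_ge0.
  + by case: ifP => // _; exact: share_ge0.
  + by case: ifP.
- move=> [x|e] [y|f].
  + by move=> _; have [->|xy] := eqVneq x y; [left | right].
  + by case: ifP => [xf _|]; [right | rewrite eqxx].
  + by case: ifP => [xf _|]; [right | rewrite eqxx].
  + by have [->|_] := eqVneq e f; [left | rewrite eqxx].
- move=> [x|e]; rewrite sum_vertex.
    rewrite -mulr_suml -mulr_sumr -Sb full // -big_mkcond /=.
    by rewrite /residual subrK.
  rewrite -big_mkcond sum_share // -big_mkcond /= (bigD1 e) ?eqxx //= big1 ?addr0.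
    by rewrite /db subrK.
  by move=> f /andP[/eqP ->]; rewrite eqxx.
- move=> [x|e]; rewrite sum_vertex.
    rewrite -mulr_suml -mulr_suml -/S [S * _]mulrC full // -big_mkcond /=.
    by rewrite /residual subrK.
  rewrite -big_mkcond sum_share // -big_mkcond /= (bigD1 e) ?eqxx //= big1 ?addr0.
    by rewrite /da subrK.
  by move=> f /andP[/eqP ->]; rewrite eqxx.
Qed.

Definition facet := ((vertex + vertex) + (edge + edge))%type.

Definition lform (T : pzRingType) (v : vertex) : 'cV[T]_(#|vertex| + #|vertex|) :=
  delta_mx (lshift _ (enum_rank v)) 0.
Definition rform (T : pzRingType) (v : vertex) : 'cV[T]_(#|vertex| + #|vertex|) :=
  delta_mx (rshift _ (enum_rank v)) 0.

Definition form (T : pzRingType) (j : facet) : 'cV[T]_(#|vertex| + #|vertex|) :=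
  match j with
  | inl (inl v) => lform T v
  | inl (inr v) => rform T v
  | inr (inl e) => rform T (inr e) + \sum_(x in val e) rform T (inl x) - lform T (inr e)
  | inr (inr e) => lform T (inr e) + \sum_(x in val e) lform T (inl x) - rform T (inr e)
  end.

Lemma lformE (T : pzRingType) (x : 'rV[T]_(#|vertex| + #|vertex|)) v :
  (x *m lform T v) 0 0 = lcoord x v.
Proof. by rewrite -colE mxE. Qed.
Lemma rformE (T : pzRingType) (x : 'rV[T]_(#|vertex| + #|vertex|)) v :
  (x *m rform T v) 0 0 = rcoord x v.
Proof. by rewrite -colE mxE. Qed.

Lemma formE (T : pzRingType) (x : 'rV[T]_(#|vertex| + #|vertex|)) (j : facet) :
  (x *m form T j) 0 0 = match j with
  | inl (inl v) => lcoord x v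
  | inl (inr v) => rcoord x v
  | inr (inl e) => rcoord x (inr e) + \sum_(u in val e) rcoord x (inl u) - lcoord x (inr e)
  | inr (inr e) => lcoord x (inr e) + \sum_(u in val e) lcoord x (inl u) - rcoord x (inr e)
  end.
Proof.
case: j => [[v|v]|[e|e]] /=; rewrite ?lformE ?rformE //.
  rewrite mulmxBr mulmxDr mulmx_sumr [LHS]mxE [in LHS]mxE summxE [X in _ + X]mxE lformE rformE.
  by congr (_ + _ - _); apply: eq_bigr => u _; rewrite rformE.
rewrite mulmxBr mulmxDr mulmx_sumr [LHS]mxE [in LHS]mxE summxE [X in _ + X]mxE lformE rformE.
by congr (_ + _ - _); apply: eq_bigr => u _; rewrite lformE.
Qed.

Lemma intmx_form (j : facet) : intmx R (form int j) = form R j.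
Proof.
rewrite /intmx; case: j => [[v|v]|[e|e]] /=; rewrite ?map_mxB ?map_mxD ?map_delta_mx //.
  by rewrite raddf_sum; congr (_ + _ - _); apply: eq_bigr => u _; rewrite /= map_delta_mx.
by rewrite raddf_sum; congr (_ + _ - _); apply: eq_bigr => u _; rewrite /= map_delta_mx.
Qed.

(** A capacity form could be negative only at a point with the new vertex of e on its negative side;
    the other end is then that vertex itself or an endpoint of e, and restores at least 1. *)
Lemma PQ_point_form (i j : vertex) (f : facet) :
  i = j \/ adj graph i j -> 0 <= (PQ_point R i j *m form R f) 0 0.
Proof.
have ind_ge0 (e : edge) (g : 'I_N -> bool) : 0 <= \sum_(u in val e) (g u)%:R :> R.
  by apply: sumr_ge0.
have ind_ge1 (e : edge) (x : 'I_N) : x \in val e ->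
    1 <= \sum_(u in val e) (inl u == inl x :> vertex)%:R :> R.
  by move=> xe; rewrite (bigD1 x) //= eqxx lerDl sumr_ge0.
move=> ij; rewrite formE; case: f => [[v|v]|[e|e]]; rewrite ?lcoord_PQ ?rcoord_PQ //.
- under eq_bigr do rewrite rcoord_PQ.
  have [ei|_] := eqVneq (inr e : vertex) i; last first.
    by rewrite subr0 addr_ge0 // (ind_ge0 e (fun u => inl u == j)).
  case: ij => [<-|]; rewrite -ei.
    by rewrite eqxx addrAC subrr add0r (ind_ge0 e (fun u => inl u == _)).
  by case: j => //= x xe; rewrite subr_ge0 add0r; exact: ind_ge1.
- under eq_bigr do rewrite lcoord_PQ.
  have [ei|_] := eqVneq (inr e : vertex) j; last first.
    by rewrite subr0 addr_ge0 // (ind_ge0 e (fun u => inl u == i)).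
  case: ij => [->|]; rewrite -ei.
    by rewrite eqxx addrAC subrr add0r (ind_ge0 e (fun u => inl u == _)).
  by case: i => //= x xe; rewrite subr_ge0 add0r; exact: ind_ge1.
Qed.

Lemma PQ_triangleP (x : 'rV[R]_(#|vertex| + #|vertex|)) :
  PQ_polytope R graph x <->
  x *m height_mx R #|vertex| = const_mx 1 /\ forall j : facet, 0 <= (x *m form R j) 0 0.
Proof.
split=> [Px|[/coord_heightP[xl xr] h]].
  split=> [|j]; first exact: PQ_height Px.
  by apply: PQ_ind Px => u v uv; exact: PQ_point_form.
have [|||||phi [phi0 phiG hl hr]] := @triangle_flow (lcoord x) (rcoord x).
- by move=> v; have := h (inl (inl v)); rewrite formE.
- by move=> v; have := h (inl (inr v)); rewrite formE.
- by rewrite xl xr.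
- by move=> e; have := h (inr (inl e)); rewrite formE subr_ge0.
- by move=> e; have := h (inr (inr e)); rewrite formE subr_ge0.
exact: PQ_flow phi0 phiG hl hr xl.
Qed.

Lemma direction_PQ (i j k l : vertex) : (i = j \/ adj graph i j) -> (k = l \/ adj graph k l) ->
  direction (PQ_polytope R graph) (PQ_point R i j - PQ_point R k l).
Proof. by move=> ij kl t x; apply: affine_hull_shift; exact: PQ_pointP. Qed.

Lemma affine_hull_triangle : (0 < N)%N ->
  affine_hull (PQ_polytope R graph) = [set x | x *m height_mx R #|vertex| = const_mx 1].
Proof.
move=> N0; pose r : vertex := inl (Ordinal N0).
have rl x : inl x = r \/ adj graph (inl x) r.
  by have [->|xr] := eqVneq x (Ordinal N0); [left | right].
have rr x : r = inl x \/ adj graph r (inl x).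
  by have [->|xr] := eqVneq x (Ordinal N0); [left | right; rewrite adj_sym].
(* A new vertex is reached through an endpoint u of its edge: the difference of two points with a
   common right end does not depend on that end, so r may be replaced by the new vertex. *)
have split_l (e : edge) u : PQ_point R (inr e) r - PQ_point R r r =
    (PQ_point R (inr e) (inr e) - PQ_point R (inl u) (inr e)) +
    (PQ_point R (inl u) r - PQ_point R r r).
  by rewrite (PQ_pointBl _ _ _ (inr e) r) addrA subrK.
have split_r (e : edge) u : PQ_point R r (inr e) - PQ_point R r r =
    (PQ_point R (inr e) (inr e) - PQ_point R (inr e) (inl u)) +
    (PQ_point R r (inl u) - PQ_point R r r).
  by rewrite (PQ_pointBr _ _ _ (inr e) r) addrA subrK.
apply: (affine_hull_PQ (r := r)) => -[x|e].
- by apply: direction_PQ; [exact: rl | left].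
- have [u [v [uv ee]]] := matching_edge hMM e; rewrite (split_l e u); apply: directionD.
    by apply: direction_PQ; [left | right; rewrite /= ee finset.set21].
  by apply: direction_PQ; [exact: rl | left].
- by apply: direction_PQ; [exact: rr | left].
- have [u [v [uv ee]]] := matching_edge hMM e; rewrite (split_r e u); apply: directionD.
    by apply: direction_PQ; [left | right; rewrite /= ee finset.set21].
  by apply: direction_PQ; [exact: rr | left].
Qed.

Definition vec (z : vpair vertex) : 'rV[int]_(#|vertex| + #|vertex|) :=
  row_mx (\row_i (z.1 (enum_val i))%:Z) (\row_i (z.2 (enum_val i))%:Z).

Lemma lcoord_vec z v : lcoord (vec z) v = (z.1 v)%:Z.
Proof. by rewrite /lcoord row_mxEl mxE enum_rankK. Qed.
Lemma rcoord_vec z v : rcoord (vec z) v = (z.2 v)%:Z.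
Proof. by rewrite /rcoord row_mxEr mxE enum_rankK. Qed.

Lemma vec_inj : injective vec.
Proof.
move=> [a b] [a' b'] e; congr (_, _); apply/ffunP => v; apply/eqP; rewrite -eqz_nat; apply/eqP.
  by have := congr1 (fun x => lcoord x v) e; rewrite !lcoord_vec.
by have := congr1 (fun x => rcoord x v) e; rewrite !rcoord_vec.
Qed.

Lemma vec_valid (m : nat) (z : vpair vertex) : reflect
  (vec z *m height_mx int #|vertex| = const_mx m%:Z /\
   forall j : facet, 0 <= (vec z *m form int j) 0 0)
  (z \in valid [set: vertex]%SET (@admissible N MM) m m).
Proof.
have rT a : frestrict [set: vertex]%SET a = a by apply/ffunP => v; rewrite ffunE finset.in_setT.
have sumZ (I : finType) (P : pred I) (f : I -> nat) :
    \sum_(i | P i) (f i)%:Z = (\sum_(i | P i) f i)%N%:Z.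
  by rewrite (big_morph Posz PoszD (erefl 0)).
have hl : \sum_v lcoord (vec z) v = (mass z.1)%:Z.
  by rewrite -sumZ; apply: eq_bigr => v _; exact: lcoord_vec.
have hr : \sum_v rcoord (vec z) v = (mass z.2)%:Z.
  by rewrite -sumZ; apply: eq_bigr => v _; exact: rcoord_vec.
have sl (e : edge) :
    \sum_(u in val e) lcoord (vec z) (inl u) = (\sum_(u in val e) z.1 (inl u))%N%:Z.
  by rewrite -sumZ; apply: eq_bigr => u _; exact: lcoord_vec.
have sr (e : edge) :
    \sum_(u in val e) rcoord (vec z) (inl u) = (\sum_(u in val e) z.2 (inl u))%N%:Z.
  by rewrite -sumZ; apply: eq_bigr => u _; exact: rcoord_vec.
rewrite in_valid /frestrict2 !rT -surjective_pairing eqxx /=.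
apply: (iffP and3P) => [[/eqP t1 /eqP t2 /forallP h]|[/coord_heightP[]]].
  split; first by apply/coord_heightP; rewrite hl hr t1 t2.
  move=> j; rewrite formE; case: j => [[v|v]|[e|e]]; rewrite ?lcoord_vec ?rcoord_vec //.
    by have /andP[h1 _] := h e; rewrite sr subr_ge0 -PoszD lez_nat.
  by have /andP[_ h1] := h e; rewrite sl subr_ge0 -PoszD lez_nat.
rewrite hl hr => -[->] [->] h; split=> //; apply/forallP => e; apply/andP; split.
  by have := h (inr (inl e)); rewrite formE lcoord_vec rcoord_vec sr subr_ge0 -PoszD lez_nat.
by have := h (inr (inr e)); rewrite formE lcoord_vec rcoord_vec sl subr_ge0 -PoszD lez_nat.
Qed.

Lemma vec_surj (x : 'rV[int]_(#|vertex| + #|vertex|)) :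
  (forall j : facet, 0 <= (x *m form int j) 0 0) -> exists z, x = vec z.
Proof.
move=> h; exists ([ffun v => absz (lcoord x v)], [ffun v => absz (rcoord x v)]).
apply: coordP => v; rewrite (lcoord_vec, rcoord_vec) ffunE gez0_abs //.
  by have := h (inl (inl v)); rewrite formE.
by have := h (inl (inr v)); rewrite formE.
Qed.

Lemma lattice_points : exists pts : nat -> seq 'rV[int]_(#|vertex| + #|vertex|),
  [/\ forall m, uniq (pts m),
      forall m z, z \in pts m <-> z *m height_mx int #|vertex| = const_mx m%:Z /\
        forall j : facet, 0 <= (z *m form int j) 0 0
    & forall m, (size (pts m))%:Z =
        central (nconfig (N - 2 * #|MM|) (N - 2 * #|MM|) #|MM|) m].
Proof.
have [s hs] := enumerates_triangle hMM.
exists (fun m => [seq vec z | z <- s m m]); split=> [m|m z|m].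
- by rewrite map_inj_uniq; [have [] := hs m m | exact: vec_inj].
- have [_ es _] := hs m m; split=> [/mapP[y ys ->]|[ze h]].
    by apply/vec_valid; rewrite -es.
  have [y ey] := vec_surj h; apply/mapP; exists y => //; rewrite es; apply/vec_valid.
  by rewrite -ey.
- by rewrite size_map; have [_ _ ->] := hs m m.
Qed.

Lemma card_vertex : #|vertex| = (N + #|MM|)%N.
Proof. by rewrite card_sum card_ord card_sig. Qed.

(** The all-ones vector is the interior lattice point for the volume estimate; its capacity forms
    equal 1 + 2 - 1 = 2. *)
Lemma const1_form (j : facet) :
  1 <= ((const_mx 1 : 'rV[int]_(#|vertex| + #|vertex|)) *m form int j) 0 0.
Proof.
have h (e : edge) : 1 + \sum_(u in val e) 1 - 1 = 2 :> int.
  by have [u [v [uv ->]]] := matching_edge hMM e; rewrite sumr_const cards2 uv.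
rewrite formE /lcoord /rcoord; case: j => [[v|v]|[e|e]]; rewrite ?mxE //;
  by under eq_bigr do rewrite mxE; rewrite h.
Qed.

End TrianglePolytope.

(** * Evaluation of the normalized volume *)

Local Open Scope ring_scope.

Theorem theorem2p9 (R : realType) (N M : nat) (MM : {set {set 'I_N}})
  (hN : (2 <= N)%N)
  (hMM : is_matching (complete_graph N) MM)
  (hM : #|MM| = M) :
  NVol (PQ_polytope R (triangle_graph (complete_graph N) MM)) =
    ((3 ^ M * 'C(2 * (N - 1), N - 1))%N%:R%R)%:E.
Proof.
have N0 : (0 < N)%N by lia.
have V0 : (0 < #|triangle_vertex MM|)%N by rewrite card_vertex; lia.
have aff := affine_hull_triangle R hMM N0.
have [pts [upts ptsP szpts]] := lattice_points hMM.
have M2 := matched_le hMM.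
apply: NVol_height_pos => // p B ch.
have facets x : PQ_polytope R (triangle_graph (complete_graph N) MM) x <->
    x *m intmx R (height_mx int _) = const_mx 1 /\
    forall j : facet MM, 0 <= (x *m intmx R (form int j)) 0 0.
  rewrite intmx_height; split.
    by move=> /(PQ_triangleP hMM)[? h]; split=> // j; rewrite intmx_form.
  by move=> [? h]; apply/(PQ_triangleP hMM); split=> // j; rewrite -intmx_form.
rewrite -intmx_height in aff.
(* Each half of the all-ones vector sums to the number of vertices, which is therefore its
   height. *)
apply: (chart_volume facets aff ch (z0 := const_mx 1) (n0 := #|triangle_vertex MM|) _ _ upts ptsP).
- by apply/coord_heightP; split; under eq_bigr do rewrite /lcoord /rcoord mxE;
    rewrite sumr_const natz.
- exact: const1_form.
(* With p = q = N - 2 M and r = M, the parameters of [lead_config] become k = 2 (N + M - 1), the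
   dimension, n = 2 (N - 1) and l = N - 1. *)
have ld : lead (#|triangle_vertex MM|.-1 + #|triangle_vertex MM|.-1)
    (3 ^ M * 'C(2 * (N - 1), N - 1))%N%:Z (central (nconfig (N - 2 * M) (N - 2 * M) M)).
  by apply: lead_config; rewrite ?card_vertex ?hM; lia.
have := cvg_lead (R := R) ld; rewrite -hM.
under eq_fun do rewrite -szpts.
by [].
Qed.
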